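(* Let $n$ be a natural number and $0<\sigma_0<2$. There is a constant $C>0$ such that, with $b=C\log t$, as $t\to+\infty$, \[ U(t)=\frac{1}{2\pi i}\int_{-b-i\sigma_0}^{\,b-i\sigma_0} e^{i\vartheta(t+x)-i\vartheta(t)}\,\zeta\bigl(\tfrac12+i(t+x)\bigr)\,\frac{\pi}{2\sinh\frac{\pi x}{2}}\,dx+O(t^{-n}), \] the integral being over the horizontal segment from $-b-i\sigma_0$ to $b-i\sigma_0$ (the implied constant may depend on $n$ and $\sigma_0$).
   Context: $\vartheta$ is the Riemann–Siegel theta function: the holomorphic function on $\mathbb C\setminus(\{iy:y\ge\frac12\}\cup\{iy:y\le-\frac12\})$ with $\vartheta(0)=0$ and $e^{i\vartheta(t)}=\pi^{-it/2}\sqrt{\Gamma(\frac14+\frac{it}{2})/\Gamma(\frac14-\frac{it}{2})}$. $\zeta$ is the Riemann zeta function. For real $t$, \[ U(t)=\frac{1}{2\pi i}\int_{-i\sigma-\infty}^{-i\sigma+\infty} e^{i\vartheta(t+x)-i\vartheta(t)}\,\zeta\bigl(\tfrac12+i(t+x)\bigr)\,\frac{\pi}{2\sinh\frac{\pi x}{2}}\,dx,\qquad 0<\sigma<\tfrac12, \] which is independent of $\sigma\in(0,\frac12)$. *)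

(* Defs.v *)
From Stdlib Require Import Reals Factorial.
From Coquelicot Require Import Coquelicot.
Open Scope R_scope.

Definition cexp (z : C) : C :=
  (exp (Re z) * cos (Im z), exp (Re z) * sin (Im z)).

Definition carg (z : C) : R :=
  if Rlt_dec 0 (Re z) then atan (Im z / Re z)
  else if Rlt_dec (Re z) 0 then
    (if Rle_dec 0 (Im z) then atan (Im z / Re z) + PI
     else atan (Im z / Re z) - PI)
  else if Rlt_dec 0 (Im z) then PI / 2
  else if Rlt_dec (Im z) 0 then - (PI / 2)
  else 0.

Definition clog (z : C) : C := (ln (Cmod z), carg z).

Definition clim (u : nat -> C) : C :=
  (real (Lim_seq (fun n => Re (u n))), real (Lim_seq (fun n => Im (u n)))).

(** Principal branch of log Gamma on C \ (-oo,0], via Gauss' limit formula: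
    log Gamma(z) = lim_n ( ln n! + z ln n - sum_{k=0}^n Log (z+k) ). *)
Definition logGamma (z : C) : C :=
  clim (fun n =>
    (RtoC (ln (INR (fact n))) + z * RtoC (ln (INR n))
     - sum_n (fun k => clog (z + RtoC (INR k))) n)%C).

(** Riemann–Siegel theta function, as a holomorphic function on
    C \ ({iy : y >= 1/2} U {iy : y <= -1/2}):
    theta(t) = (logGamma(1/4 + i t/2) - logGamma(1/4 - i t/2)) / (2i) - (t/2) ln pi.
    It satisfies theta(0) = 0 and
    exp(i theta(t)) = pi^(-it/2) sqrt(Gamma(1/4+it/2)/Gamma(1/4-it/2)). *)
Definition RStheta (t : C) : C :=
  ((logGamma (RtoC (1/4) + Ci * t / RtoC 2)
    - logGamma (RtoC (1/4) - Ci * t / RtoC 2)) / (RtoC 2 * Ci)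
   - t / RtoC 2 * RtoC (ln PI))%C.

Definition rpowC (x : R) (s : C) : C := cexp (s * RtoC (ln x))%C.

(** Riemann zeta function in the half-plane Re s > 0 (s <> 1), by the
    classical continuation
      zeta(s) = s/(s-1) - s * int_1^oo {x} x^(-s-1) dx. *)
Definition zeta (s : C) : C :=
  (s / (s - RtoC 1)
   - s * @RInt_gen C_R_CompleteNormedModule
           (fun x : R => (RtoC (frac_part x) * rpowC x (- s - RtoC 1))%C)
           (at_point 1) (Rbar_locally p_infty))%C.

Definition csinh (z : C) : C := ((cexp z - cexp (- z)) / RtoC 2)%C.

Definition Uintegrand (t : R) (x : C) : C :=
  (cexp (Ci * RStheta (RtoC t + x) - Ci * RStheta (RtoC t))
   * zeta (RtoC (1/2) + Ci * (RtoC t + x))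
   * (RtoC PI / (RtoC 2 * csinh (RtoC PI * x / RtoC 2))))%C.

Definition Uline (sigma t : R) : C :=
  (/ (RtoC (2 * PI) * Ci) *
   @RInt_gen C_R_CompleteNormedModule
     (fun u : R => Uintegrand t (RtoC u - Ci * RtoC sigma))
     (Rbar_locally m_infty) (Rbar_locally p_infty))%C.

(** U(t); the integral is independent of sigma in (0,1/2); we take sigma = 1/4. *)
Definition U (t : R) : C := Uline (1/4) t.

Definition Useg (sigma0 b t : R) : C :=
  (/ (RtoC (2 * PI) * Ci) *
   @RInt C_R_CompleteNormedModule
     (fun u : R => Uintegrand t (RtoC u - Ci * RtoC sigma0)) (- b) b)%C.

(* Main.v *)
Require Import Defs.
From Stdlib Require Import Reals Lra Lia Factorial.
From Coquelicot Require Import Coquelicot.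
Open Scope R_scope.

(** On the line [Im x = -1/4] the integrand is [O(t^2 exp(-|Re x|/2))]: the
    kernel [1/sinh] beats the polynomial growth of [exp(i theta)] and [zeta], so
    cutting the line at [|Re x| = b = 2(n+2) ln t] costs [O(t^-n)].  The segment
    is then moved from height [-1/4] to height [-sigma0]; inside [-2 < Im x < 0],
    [|Re x| <= b < t] the integrand is holomorphic (the pole of zeta sits at
    [x = -t - i/2]), and the vertical sides are as small as the tails.

    The shift is carried out for elementary approximations of the integrand, with
    log Gamma replaced by a term of Gauss' sequence and the integral defining zeta
    cut at an integer.  These are explicitly holomorphic, they satisfy the same
    bounds, and they converge uniformly on segments. *)

(** * Complex differentiation *)

(* Coquelicot gives C two uniform structures: product balls on [C_R_NormedModule], used for
   paths and integrals, and modulus balls on the absolute ring [C_AbsRing], used for complex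
   derivatives; [locally_C] says that they have the same neighbourhoods. *)
Local Notation C_selfModule := (AbsRing_NormedModule C_AbsRing).
Local Notation C_selfSpace := (AbsRing_UniformSpace C_AbsRing).
Local Notation is_derive_RC := (@is_derive R_AbsRing C_R_NormedModule).
Local Notation is_derive_CC := (@is_derive C_AbsRing C_selfModule).
Local Notation continuous_CC := (@continuous C_selfSpace C_selfSpace).
Local Notation is_RIntC := (@is_RInt C_R_NormedModule).
Local Notation ex_RIntC := (@ex_RInt C_R_NormedModule).
Local Notation RIntC := (@RInt C_R_CompleteNormedModule).

Local Ltac eq_in_C := match goal with |- @eq _ ?a ?b => change (@eq C a b) end.

Lemma norm_C_R (z : C) : @norm R_AbsRing C_R_NormedModule z = Cmod z.
Proof. symmetry; apply Cmod_norm. Qed.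

Lemma scal_C_R (k : R) (z : C) : @scal R_AbsRing C_R_NormedModule k z = (RtoC k * z)%C.
Proof.
  apply injective_projections; unfold scal; simpl; unfold scal; simpl; unfold mult; simpl; ring.
Qed.

Lemma Cmod_le_Rabs (z : C) : Cmod z <= Rabs (Re z) + Rabs (Im z).
Proof.
  replace z with (RtoC (Re z) + RtoC (Im z) * Ci)%C at 1
    by (destruct z; apply injective_projections; simpl; ring).
  eapply Rle_trans; [apply Cmod_triangle |].
  rewrite Cmod_mult, Cmod_Ci, !Cmod_R; lra.
Qed.

Lemma im_le_Cmod (z : C) : Rabs (Im z) <= Cmod z.
Proof. eapply Rle_trans; [apply Rmax_r | apply (Rmax_Cmod z)]. Qed.

Lemma RtoC_neq0 (x : R) : x <> 0 -> RtoC x <> 0%C.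
Proof. intros Hx E; apply Hx, RtoC_inj, E. Qed.

Lemma is_derive_C_R_iff (f : R -> C) (x : R) (l : C) :
  is_derive_RC f x l <->
  is_derive (fun t => Re (f t)) x (Re l) /\ is_derive (fun t => Im (f t)) x (Im l).
Proof.
  split.
  - intros H; split.
    + apply (filterdiff_comp' (U:=R_NormedModule) f (fun z : C_R_NormedModule => Re z) x
               (fun y => scal y (l : C_R_NormedModule)) (fun z => Re z) H).
      apply filterdiff_linear, is_linear_fst.
    + apply (filterdiff_comp' (U:=R_NormedModule) f (fun z : C_R_NormedModule => Im z) x
               (fun y => scal y (l : C_R_NormedModule)) (fun z => Im z) H).
      apply filterdiff_linear, is_linear_snd.
  - intros [H1 H2].
    assert (H := is_derive_plus (V:=C_R_NormedModule) _ _ _ _ _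
      (is_derive_scal_l (V:=C_R_NormedModule) _ _ _ (RtoC 1) H1)
      (is_derive_scal_l (V:=C_R_NormedModule) _ _ _ Ci H2)).
    assert (E : forall z : C, plus (scal (Re z) (RtoC 1 : C_R_NormedModule))
                                  (scal (Im z) (Ci : C_R_NormedModule)) = z).
    { intros [a b]; rewrite !scal_C_R; apply injective_projections; simpl;
        unfold plus; simpl; ring. }
    rewrite E in H; revert H; apply is_derive_ext; intros t; apply E.
Qed.

Lemma is_derive_RC_plus (f g : R -> C) (x : R) (l m : C) :
  is_derive_RC f x l -> is_derive_RC g x m -> is_derive_RC (fun t => f t + g t)%C x (l + m)%C.
Proof. exact (is_derive_plus (V:=C_R_NormedModule) f g x l m). Qed.

Lemma is_derive_RC_minus (f g : R -> C) (x : R) (l m : C) :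
  is_derive_RC f x l -> is_derive_RC g x m -> is_derive_RC (fun t => f t - g t)%C x (l - m)%C.
Proof. exact (is_derive_minus (V:=C_R_NormedModule) f g x l m). Qed.

Lemma is_derive_RC_ray (h : C) (t : R) : is_derive_RC (fun t => RtoC t * h)%C t h.
Proof. destruct h; apply is_derive_C_R_iff; split; simpl; auto_derive; auto; ring. Qed.

Lemma is_derive_RC_line (z h : C) (t : R) : is_derive_RC (fun t => z + RtoC t * h)%C t h.
Proof. destruct z, h; apply is_derive_C_R_iff; split; simpl; auto_derive; auto; ring. Qed.

Lemma is_derive_CC_filterdiff (f : C -> C) (z l : C) : is_derive_CC f z l ->
  @filterdiff R_AbsRing C_R_NormedModule C_R_NormedModule f (@locally C_R_NormedModule z)
    (fun h => (h * l)%C).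
Proof.
  intros [_ H]; split.
  - split.
    + intros x y; exact (Cmult_plus_distr_r x y l).
    + intros k x; rewrite !scal_C_R; symmetry; apply Cmult_assoc.
    + exists (Cmod l + 1); split; [pose proof (Cmod_ge_0 l); lra |].
      intros x; rewrite !norm_C_R, Cmod_mult.
      pose proof (Cmod_ge_0 x); pose proof (Cmod_ge_0 l); nra.
  - intros x Hx; apply (is_filter_lim_locally_unique (V:=C_R_NormedModule)) in Hx; subst x.
    intros eps; apply locally_C.
    generalize (H z (fun P HP => HP) eps); apply filter_imp; intros y Hy.
    rewrite !norm_C_R; exact Hy.
Qed.

Lemma is_derive_CC_path (f : C -> C) (g : R -> C) (x : R) (l d : C) :
  is_derive_CC f (g x) l -> is_derive_RC g x d -> is_derive_RC (fun t => f (g t)) x (l * d)%C.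
Proof.
  intros Hf Hg.
  apply filterdiff_ext_lin with (fun y : R => (scal y (d : C_R_NormedModule) * l)%C).
  - exact (filterdiff_comp' (U:=R_NormedModule) g f x _ _ Hg (is_derive_CC_filterdiff f _ l Hf)).
  - intros y; rewrite !scal_C_R; symmetry.
    change (RtoC y * (l * d) = RtoC y * d * l)%C; ring.
Qed.

(* The increment is projected onto its own direction, which keeps the real constant [M]. *)
Lemma Cmod_mean_value_le (h dh : R -> C) (M x y : R) :
  (forall t, Rmin x y <= t <= Rmax x y -> is_derive_RC h t (dh t) /\ Cmod (dh t) <= M) ->
  Cmod (h y - h x)%C <= M * Rabs (y - x).
Proof.
  intros H; pose (d := (h y - h x)%C); fold d.
  assert (Hd := Cmod_ge_0 d).
  assert (Dproj : forall t, Rmin x y <= t <= Rmax x y ->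
    is_derive (fun t => Re (Cconj d * h t)%C) t (Re (Cconj d * dh t)%C)).
  { intros t Ht; destruct (H t Ht) as [Hh _].
    apply (is_derive_C_R_iff h) in Hh as [H1 H2]; simpl.
    exact (is_derive_minus (V:=R_NormedModule) _ _ _ _ _
      (is_derive_scal _ _ (fst d) _ H1) (is_derive_scal _ _ (- snd d) _ H2)). }
  destruct (MVT_gen (fun t => Re (Cconj d * h t)%C) x y (fun t => Re (Cconj d * dh t)%C))
    as (c & Hc & E).
  - intros t Ht; apply Dproj; lra.
  - intros t Ht; apply derivable_continuous_pt; eexists; apply is_derive_Reals, Dproj, Ht.
  - replace (Re (Cconj d * h y)%C - Re (Cconj d * h x)%C) with (Cmod d ^ 2) in E
      by (rewrite Cmod2_alt; unfold d; destruct (h x), (h y); simpl; ring).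
    assert (B : Re (Cconj d * dh c)%C * (y - x) <= Cmod d * M * Rabs (y - x)).
    { eapply Rle_trans; [apply Rle_abs |]; rewrite Rabs_mult.
      apply Rmult_le_compat_r; [apply Rabs_pos |].
      eapply Rle_trans; [apply re_le_Cmod |]; rewrite Cmod_mult, Cmod_conj.
      apply Rmult_le_compat_l; [exact Hd | apply H, Hc]. }
    destruct Hd as [Hd | Hd]; [apply (Rmult_le_reg_l (Cmod d)); nra |].
    rewrite <- Hd; apply Rmult_le_pos; [| apply Rabs_pos].
    eapply Rle_trans; [apply Cmod_ge_0 | apply (H c Hc)].
Qed.

Lemma is_derive_RC_shift (f : C -> C) (z h l : C) (t : R) :
  is_derive_RC (fun r => f (z + RtoC t * h + RtoC r * h)%C) 0 l ->
  is_derive_RC (fun r => f (z + RtoC r * h)%C) t l.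
Proof.
  intros H; apply (is_derive_ext (fun r : R => f (z + RtoC t * h + RtoC (r - t) * h)%C)).
  { intros r; rewrite RtoC_minus; apply (f_equal f); ring. }
  evar_last.
  - apply (is_derive_comp (V:=C_R_NormedModule) (fun r => f (z + RtoC t * h + RtoC r * h)%C)
             (fun r => r - t) t).
    + rewrite Rminus_diag; exact H.
    + auto_derive; reflexivity.
  - exact (scal_one (l : C_R_NormedModule)).
Qed.

Lemma Cmod_increment_le (f f' : C -> C) (z h l : C) (eps : R) :
  (forall t : R, 0 <= t <= 1 ->
     is_derive_RC (fun r => f (z + RtoC t * h + RtoC r * h)%C) 0 (f' (z + RtoC t * h) * h)%C /\
     Cmod (f' (z + RtoC t * h) - l)%C <= eps) ->
  Cmod (f (z + h) - f z - h * l)%C <= eps * Cmod h.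
Proof.
  intros H.
  pose (g := fun t : R => (f (z + RtoC t * h) - RtoC t * (h * l))%C).
  replace (f (z + h) - f z - h * l)%C with (g 1 - g 0)%C.
  2:{ unfold g; rewrite Cmult_1_l, !Cmult_0_l, Cplus_0_r; ring. }
  replace (eps * Cmod h) with (eps * Cmod h * Rabs (1 - 0))
    by (rewrite Rminus_0_r, Rabs_R1; apply Rmult_1_r).
  apply (Cmod_mean_value_le g (fun t => (f' (z + RtoC t * h) * h - h * l)%C)).
  intros t Ht; rewrite Rmin_left, Rmax_right in Ht by lra; destruct (H t Ht) as [Hd Hc]; split.
  - apply is_derive_RC_minus; [apply is_derive_RC_shift, Hd | apply is_derive_RC_ray].
  - replace (f' (z + t * h) * h - h * l)%C with ((f' (z + t * h) - l) * h)%C by ring.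
    rewrite Cmod_mult; apply Rmult_le_compat_r; [apply Cmod_ge_0 | exact Hc].
Qed.

Lemma is_derive_CC_directional (f f' : C -> C) (z : C) :
  @locally C_selfSpace z
    (fun w => forall h, is_derive_RC (fun r => f (w + RtoC r * h)%C) 0 (f' w * h)%C) ->
  continuous_CC f' z -> is_derive_CC f z (f' z).
Proof.
  intros Hdir Hcont; split; [apply is_linear_scal_l |].
  intros x Hx eps.
  apply (is_filter_lim_locally_unique (V:=C_selfModule)) in Hx; subst x.
  destruct (filter_and _ _ Hdir (proj1 (filterlim_locally _ _) Hcont eps)) as [delta Hdelta].
  exists delta; refine (fun (y : C) Hy => _).
  change (Cmod (y - z)%C < delta) in Hy.
  change (Cmod (f y - f z - (y - z) * f' z)%C <= eps * Cmod (y - z)%C).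
  set (h := (y - z)%C) in *; replace y with (z + h)%C by (unfold h; ring).
  apply (Cmod_increment_le f f'); intros t Ht.
  destruct (Hdelta (z + RtoC t * h)%C) as [Hd Hc]; [| split; [apply Hd | left; exact Hc]].
  change (Cmod (z + RtoC t * h - z)%C < delta).
  replace (z + RtoC t * h - z)%C with (RtoC t * h)%C by ring.
  rewrite Cmod_mult, Cmod_R, Rabs_pos_eq by lra; pose proof (Cmod_ge_0 h); nra.
Qed.

(** * Exponential, inverse and logarithm *)

Lemma continuous_Re (z : C) : @continuous C_UniformSpace R_UniformSpace Re z.
Proof. destruct z; apply continuous_fst. Qed.

Lemma continuous_Im (z : C) : @continuous C_UniformSpace R_UniformSpace Im z.
Proof. destruct z; apply continuous_snd. Qed.

Lemma continuous_CC_pair (u v : C -> R) (z : C) :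
  @continuous C_UniformSpace R_UniformSpace u z -> @continuous C_UniformSpace R_UniformSpace v z ->
  continuous_CC (fun w => (u w, v w)) z.
Proof.
  intros Hu Hv; apply filterlim_locally; intros eps; apply locally_C.
  assert (He : 0 < eps / 2) by (pose proof (cond_pos eps); lra).
  apply filterlim_locally with (eps := mkposreal _ He) in Hu, Hv.
  generalize (filter_and _ _ Hu Hv); apply filter_imp; intros w [Bu Bv].
  change (Rabs (u w - u z) < eps / 2) in Bu; change (Rabs (v w - v z) < eps / 2) in Bv.
  change (Cmod ((u w, v w) - (u z, v z))%C < eps).
  eapply Rle_lt_trans; [apply Cmod_le_Rabs |]; simpl; unfold Rminus in *; lra.
Qed.

Lemma is_derive_cexp (z : C) : is_derive_CC cexp z (cexp z).
Proof.
  apply (is_derive_CC_directional cexp cexp).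
  - apply filter_forall; intros [x y] [a b].
    apply is_derive_C_R_iff; split; simpl; auto_derive; auto;
      rewrite !Rmult_0_l, ?Ropp_0, !Rplus_0_r; ring.
  - assert (Ce : @continuous C_UniformSpace R_UniformSpace (fun w => exp (Re w)) z)
      by exact (continuous_comp _ _ _ (continuous_Re _) (continuous_exp _)).
    apply continuous_CC_pair; apply (continuous_mult (K:=R_AbsRing) _ _ _ Ce).
    + exact (continuous_comp _ _ _ (continuous_Im _) (continuous_cos _)).
    + exact (continuous_comp _ _ _ (continuous_Im _) (continuous_sin _)).
Qed.

Lemma fst2_snd2_neq0 (z : C) : z <> 0%C -> fst z ^ 2 + snd z ^ 2 <> 0.
Proof. intros H E; apply H, Cmod_eq_0; unfold Cmod; rewrite E; apply sqrt_0. Qed.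

Lemma fst2_snd2_gt0 (z : C) : z <> 0%C -> 0 < fst z ^ 2 + snd z ^ 2.
Proof.
  intros H; apply fst2_snd2_neq0 in H.
  pose proof (pow2_ge_0 (fst z)); pose proof (pow2_ge_0 (snd z)); lra.
Qed.

Lemma continuous_fst2_snd2 (z : C) :
  @continuous C_UniformSpace R_UniformSpace (fun w => fst w ^ 2 + snd w ^ 2) z.
Proof.
  apply (continuous_plus (V:=R_NormedModule)).
  - apply (continuous_comp (U:=C_UniformSpace) fst (fun x => x ^ 2)); [apply continuous_Re |].
    apply (ex_derive_continuous (V:=R_NormedModule)); auto_derive; auto.
  - apply (continuous_comp (U:=C_UniformSpace) snd (fun x => x ^ 2)); [apply continuous_Im |].
    apply (ex_derive_continuous (V:=R_NormedModule)); auto_derive; auto.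
Qed.

Lemma continuous_Cinv (z : C) : z <> 0%C -> continuous_CC Cinv z.
Proof.
  intros Hz.
  assert (Ci2 : @continuous C_UniformSpace R_UniformSpace (fun w => / (fst w ^ 2 + snd w ^ 2)) z).
  { apply (continuous_comp (U:=C_UniformSpace) (fun w => fst w ^ 2 + snd w ^ 2) Rinv).
    - apply continuous_fst2_snd2.
    - apply continuous_Rinv, fst2_snd2_neq0, Hz. }
  apply continuous_CC_pair.
  - exact (continuous_mult (K:=R_AbsRing) _ _ _ (continuous_Re z) Ci2).
  - exact (continuous_mult (K:=R_AbsRing) _ _ _
      (continuous_opp (V:=R_NormedModule) _ _ (continuous_Im z)) Ci2).
Qed.

Lemma continuous_opp_Cinv_sqr (z : C) :
  z <> 0%C -> continuous_CC (fun z => - (/ z * / z))%C z.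
Proof.
  intros Hz; assert (Cz := continuous_Cinv z Hz).
  exact (continuous_opp (V:=C_selfModule) _ _ (continuous_mult (K:=C_AbsRing) _ _ _ Cz Cz)).
Qed.

Lemma locally_Cneq0 (z : C) :
  z <> 0%C -> @locally C_selfSpace z (fun w : C => w <> 0%C).
Proof.
  intros Hz; exists (mkposreal _ (proj1 (Cmod_gt_0 z) Hz)); intros w Hw ->.
  change (Cmod (0 - z)%C < Cmod z) in Hw.
  rewrite <- Cmod_opp in Hw; replace (- (0 - z))%C with z in Hw by ring; lra.
Qed.

Lemma is_derive_Cinv (z : C) : z <> 0%C -> is_derive_CC Cinv z (- (/ z * / z))%C.
Proof.
  intros Hz; apply (is_derive_CC_directional Cinv (fun z => - (/ z * / z))%C).
  - generalize (locally_Cneq0 z Hz); apply filter_imp; intros [x y] Hw [a b].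
    apply fst2_snd2_neq0 in Hw; simpl in Hw.
    apply is_derive_C_R_iff; split; simpl; auto_derive;
      rewrite ?Rmult_0_l, ?Ropp_0, ?Rplus_0_r; auto; field; lra.
  - apply continuous_opp_Cinv_sqr, Hz.
Qed.

Definition slit_plane (z : C) : Prop := 0 < Re z \/ Im z <> 0.

Lemma slit_plane_neq0 (z : C) : slit_plane z -> z <> 0%C.
Proof. intros [H | H] ->; simpl in H; lra. Qed.

Lemma carg_Re_gt0 (z : C) : 0 < Re z -> carg z = atan (Im z / Re z).
Proof. intros H; unfold carg; destruct (Rlt_dec 0 (Re z)); [reflexivity | lra]. Qed.

Lemma carg_Im_gt0 (z : C) : 0 < Im z -> carg z = PI / 2 - atan (Re z / Im z).
Proof.
  destruct z as [x y]; unfold carg; simpl; intros H.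
  destruct (Rlt_dec 0 x); [| destruct (Rlt_dec x 0)].
  - replace (y / x) with (/ (x / y)) by (field; lra).
    rewrite atan_inv by (apply Rdiv_lt_0_compat; lra); reflexivity.
  - destruct (Rle_dec 0 y); [| lra].
    replace (y / x) with (- / (- x / y)) by (field; lra).
    replace (x / y) with (- (- x / y)) by (field; lra).
    rewrite !atan_opp, atan_inv by (apply Rdiv_lt_0_compat; lra); lra.
  - destruct (Rlt_dec 0 y); [| lra].
    replace x with 0 by lra; unfold Rdiv; rewrite Rmult_0_l, atan_0; lra.
Qed.

Lemma carg_Im_lt0 (z : C) : Im z < 0 -> carg z = - (PI / 2) - atan (Re z / Im z).
Proof.
  destruct z as [x y]; unfold carg; simpl; intros H.
  destruct (Rlt_dec 0 x); [| destruct (Rlt_dec x 0)].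
  - replace (y / x) with (- / (x / - y)) by (field; lra).
    replace (x / y) with (- (x / - y)) by (field; lra).
    rewrite !atan_opp, atan_inv by (apply Rdiv_lt_0_compat; lra); lra.
  - destruct (Rle_dec 0 y); [lra |].
    replace (y / x) with (/ (- x / - y)) by (field; lra).
    replace (x / y) with (- x / - y) by (field; lra).
    rewrite atan_inv by (apply Rdiv_lt_0_compat; lra); lra.
  - destruct (Rlt_dec 0 y); [lra |]; destruct (Rlt_dec y 0); [| lra].
    replace x with 0 by lra; unfold Rdiv; rewrite Rmult_0_l, atan_0; lra.
Qed.

Lemma locally_Re_gt0 (z : C) : 0 < Re z -> @locally C_UniformSpace z (fun w => 0 < Re w).
Proof. intros H; apply (continuous_Re z (fun x => 0 < x)), open_gt, H. Qed.

Lemma locally_carg_Im_neq0 (z : C) : Im z <> 0 ->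
  exists c, @locally C_UniformSpace z (fun w => Im w <> 0 /\ carg w = c - atan (Re w / Im w)).
Proof.
  intros H; destruct (Rlt_dec 0 (Im z)).
  - exists (PI / 2); apply (filter_imp (fun w => 0 < Im w)).
    + intros w Hw; split; [lra | apply carg_Im_gt0, Hw].
    + apply (continuous_Im z (fun y => 0 < y)), open_gt; assumption.
  - exists (- (PI / 2)); apply (filter_imp (fun w => Im w < 0)).
    + intros w Hw; split; [lra | apply carg_Im_lt0, Hw].
    + apply (continuous_Im z (fun y => y < 0)), open_lt; lra.
Qed.

Lemma locally_slit_plane (z : C) :
  slit_plane z -> @locally C_UniformSpace z slit_plane.
Proof.
  intros [H | H].
  - generalize (locally_Re_gt0 z H); apply filter_imp; intros w Hw; left; exact Hw.
  - destruct (locally_carg_Im_neq0 z H) as [c Hc].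
    revert Hc; apply filter_imp; intros w [Hw _]; right; exact Hw.
Qed.

Lemma locally_line (P : C -> Prop) (w h : C) :
  @locally C_UniformSpace w P -> locally 0 (fun t : R => P (w + RtoC t * h)%C).
Proof.
  intros HP.
  apply (ex_derive_continuous (V:=C_R_NormedModule) _ _ (ex_intro _ h (is_derive_RC_line w h 0)) P).
  rewrite Cmult_0_l, Cplus_0_r; exact HP.
Qed.

Lemma is_derive_clog (z : C) : slit_plane z -> is_derive_CC clog z (/ z)%C.
Proof.
  intros Hz; apply (is_derive_CC_directional clog Cinv).
  2:{ apply continuous_Cinv, slit_plane_neq0, Hz. }
  apply locally_C; generalize (locally_slit_plane z Hz); apply filter_imp; intros w Hw h.
  assert (Hw0 := fst2_snd2_gt0 w (slit_plane_neq0 w Hw)).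
  apply is_derive_C_R_iff; split.
  - destruct w as [x y], h as [a b]; simpl in Hw0 |- *; unfold Cmod; simpl.
    assert (Hq := sqrt_lt_R0 _ Hw0); assert (Hqq := sqrt_sqrt _ (Rlt_le _ _ Hw0)).
    auto_derive; rewrite ?Rmult_0_l, ?Ropp_0, ?Rplus_0_r.
    + repeat split; lra.
    + set (q := sqrt _) in *; rewrite <- !Hqq; field; lra.
  - destruct Hw as [H | H].
    + apply (is_derive_ext_loc (fun t => atan (Im (w + RtoC t * h)%C / Re (w + RtoC t * h)%C))).
      * generalize (locally_line _ w h (locally_Re_gt0 w H)); apply filter_imp; intros t Ht.
        symmetry; apply carg_Re_gt0, Ht.
      * destruct w as [x y], h as [a b]; simpl in *.
        auto_derive; rewrite ?Rmult_0_l, ?Ropp_0, ?Rplus_0_r; [lra | field; split; lra].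
    + destruct (locally_carg_Im_neq0 w H) as [c Hc].
      apply (is_derive_ext_loc (fun t => c - atan (Re (w + RtoC t * h)%C / Im (w + RtoC t * h)%C))).
      * generalize (locally_line _ w h Hc); apply filter_imp; intros t [_ Ht].
        symmetry; exact Ht.
      * destruct w as [x y], h as [a b]; simpl in *.
        auto_derive; rewrite ?Rmult_0_l, ?Ropp_0, ?Rplus_0_r; [lra | field; split; lra].
Qed.

(** * Holomorphic functions *)

Definition holomorphic_on (D : C -> Prop) (f : C -> C) : Prop :=
  exists f' : C -> C, forall z, D z -> is_derive_CC f z (f' z) /\ continuous_CC f' z.

Lemma holomorphic_on_continuous (D : C -> Prop) (f : C -> C) (z : C) :
  holomorphic_on D f -> D z -> continuous_CC f z.
Proof.
  intros [f' H] Hz; apply (ex_derive_continuous (V:=C_selfModule)).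
  exists (f' z); apply H, Hz.
Qed.

Lemma holomorphic_on_subset (D E : C -> Prop) (f : C -> C) :
  (forall z, E z -> D z) -> holomorphic_on D f -> holomorphic_on E f.
Proof. intros H [f' Hf]; exists f'; intros z Hz; apply Hf, H, Hz. Qed.

Lemma holomorphic_on_const (D : C -> Prop) (c : C) : holomorphic_on D (fun _ => c).
Proof.
  exists (fun _ => 0%C); intros z _; split.
  - exact (@is_derive_const C_AbsRing C_selfModule c z).
  - exact (@continuous_const C_selfSpace C_selfSpace (RtoC 0) z).
Qed.

Lemma holomorphic_on_id (D : C -> Prop) : holomorphic_on D (fun z => z).
Proof.
  exists (fun _ => 1%C); intros z _; split.
  - exact (is_derive_id (K:=C_AbsRing) z).
  - exact (@continuous_const C_selfSpace C_selfSpace (RtoC 1) z).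
Qed.

Lemma holomorphic_on_plus (D : C -> Prop) (f g : C -> C) :
  holomorphic_on D f -> holomorphic_on D g -> holomorphic_on D (fun z => f z + g z)%C.
Proof.
  intros [f' Hf] [g' Hg]; exists (fun z => f' z + g' z)%C; intros z Hz.
  destruct (Hf z Hz) as [F1 F2], (Hg z Hz) as [G1 G2]; split.
  - exact (is_derive_plus (V:=C_selfModule) _ _ _ _ _ F1 G1).
  - exact (continuous_plus (V:=C_selfModule) _ _ _ F2 G2).
Qed.

Lemma holomorphic_on_mult (D : C -> Prop) (f g : C -> C) :
  holomorphic_on D f -> holomorphic_on D g -> holomorphic_on D (fun z => f z * g z)%C.
Proof.
  intros Hf Hg.
  assert (Cf := fun z => holomorphic_on_continuous D f z Hf).
  assert (Cg := fun z => holomorphic_on_continuous D g z Hg).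
  destruct Hf as [f' Hf], Hg as [g' Hg]; exists (fun z => f' z * g z + f z * g' z)%C; intros z Hz.
  destruct (Hf z Hz) as [F1 F2], (Hg z Hz) as [G1 G2]; split.
  - exact (is_derive_mult (K:=C_AbsRing) _ _ _ _ _ F1 G1 Cmult_comm).
  - exact (continuous_plus (V:=C_selfModule) _ _ _
      (continuous_mult (K:=C_AbsRing) _ _ _ F2 (Cg z Hz))
      (continuous_mult (K:=C_AbsRing) _ _ _ (Cf z Hz) G2)).
Qed.

Lemma holomorphic_on_comp (D E : C -> Prop) (f g : C -> C) :
  (forall z, D z -> E (f z)) ->
  holomorphic_on E g -> holomorphic_on D f -> holomorphic_on D (fun z => g (f z)).
Proof.
  intros HDE [g' Hg] Hf; assert (Cf := fun z => holomorphic_on_continuous D f z Hf).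
  destruct Hf as [f' Hf]; exists (fun z => f' z * g' (f z))%C; intros z Hz.
  destruct (Hf z Hz) as [F1 F2], (Hg _ (HDE z Hz)) as [G1 G2]; split.
  - exact (is_derive_comp (V:=C_selfModule) g f z _ _ G1 F1).
  - exact (continuous_mult (K:=C_AbsRing) _ _ _ F2 (continuous_comp _ _ _ (Cf z Hz) G2)).
Qed.

Lemma holomorphic_on_opp (D : C -> Prop) (f : C -> C) :
  holomorphic_on D f -> holomorphic_on D (fun z => - f z)%C.
Proof.
  intros [f' Hf]; exists (fun z => - f' z)%C; intros z Hz; destruct (Hf z Hz) as [F1 F2]; split.
  - exact (is_derive_opp (V:=C_selfModule) _ _ _ F1).
  - exact (continuous_opp (V:=C_selfModule) _ _ F2).
Qed.

Lemma holomorphic_on_minus (D : C -> Prop) (f g : C -> C) :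
  holomorphic_on D f -> holomorphic_on D g -> holomorphic_on D (fun z => f z - g z)%C.
Proof. intros Hf Hg; apply holomorphic_on_plus, holomorphic_on_opp; assumption. Qed.

Lemma holomorphic_on_div (D : C -> Prop) (f g : C -> C) : (forall z, D z -> g z <> 0%C) ->
  holomorphic_on D f -> holomorphic_on D g -> holomorphic_on D (fun z => f z / g z)%C.
Proof.
  intros Hg0 Hf Hg; apply holomorphic_on_mult; [exact Hf |].
  apply (holomorphic_on_comp D (fun z => z <> 0%C) g Cinv); [exact Hg0 | | exact Hg].
  exists (fun z => - (/ z * / z))%C; intros z Hz.
  split; [apply is_derive_Cinv, Hz | apply continuous_opp_Cinv_sqr, Hz].
Qed.

Lemma holomorphic_on_cexp (D : C -> Prop) (f : C -> C) :
  holomorphic_on D f -> holomorphic_on D (fun z => cexp (f z)).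
Proof.
  apply (holomorphic_on_comp D (fun _ => True) f cexp); [trivial |].
  exists cexp; intros z _; split; [apply is_derive_cexp |].
  apply (ex_derive_continuous (V:=C_selfModule)).
  exists (cexp z); apply is_derive_cexp.
Qed.

Lemma holomorphic_on_clog (D : C -> Prop) (f : C -> C) : (forall z, D z -> slit_plane (f z)) ->
  holomorphic_on D f -> holomorphic_on D (fun z => clog (f z)).
Proof.
  intros Hs; apply (holomorphic_on_comp D slit_plane f clog Hs).
  exists Cinv; intros z Hz; split; [apply is_derive_clog, Hz |].
  apply continuous_Cinv, slit_plane_neq0, Hz.
Qed.

Lemma holomorphic_on_ext (D : C -> Prop) (f g : C -> C) :
  (forall z, f z = g z) -> holomorphic_on D f -> holomorphic_on D g.
Proof.
  intros E [f' H]; exists f'; intros z Hz; destruct (H z Hz) as [H1 H2]; split; [| exact H2].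
  exact (is_derive_ext (V:=C_selfModule) f g z _ E H1).
Qed.

Lemma holomorphic_on_sum_n (D : C -> Prop) (f : nat -> C -> C) (n : nat) :
  (forall k, holomorphic_on D (f k)) -> holomorphic_on D (fun z => sum_n (fun k => f k z) n).
Proof.
  intros H; induction n as [|n IH].
  - apply (holomorphic_on_ext D (f 0%nat)); [| apply H].
    intros z; rewrite sum_O; reflexivity.
  - apply (holomorphic_on_ext D (fun z => sum_n (fun k => f k z) n + f (S n) z)%C).
    + intros z; rewrite sum_Sn; reflexivity.
    + apply holomorphic_on_plus; [exact IH | apply H].
Qed.

(** * Moving a horizontal segment *)

Lemma continuity_2d_pt_continuous_snd (g : R -> R -> R) (x y : R) :
  continuity_2d_pt g x y -> continuous (g x) y.
Proof.
  intros H; apply continuity_2d_pt_filterlim in H.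
  apply (continuous_comp_2 (fun _ => x) (fun v => v) g y);
    [apply continuous_const | apply continuous_id | exact H].
Qed.

Lemma continuous_CC_continuity_2d (f : C -> C) (x y : R) : continuous_CC f (x, y) ->
  continuity_2d_pt (fun y x => Re (f (x, y))) y x /\
  continuity_2d_pt (fun y x => Im (f (x, y))) y x.
Proof.
  intros H.
  assert (Hswap : filterlim (fun z : R * R => f (snd z, fst z)) (locally (y, x))
                    (@locally C_selfSpace (f (x, y)))).
  { apply (filterlim_comp _ _ _ (fun z : R * R => (snd z, fst z)) f _
             (@locally C_selfSpace (x, y))); [| exact H].
    intros P HP; apply locally_C in HP; destruct HP as [d Hd]; exists d; intros [v u] [Hv Hu].
    apply Hd; split; assumption. }
  split; apply continuity_2d_pt_filterlim; apply (filterlim_comp _ _ _ _ _ _ _ _ Hswap);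
    intros P HP; apply locally_C.
  - exact (continuous_Re (f (x, y)) P HP).
  - exact (continuous_Im (f (x, y)) P HP).
Qed.

Lemma is_RInt_C_R_iff (f : R -> C) (a b : R) (l : C) :
  is_RIntC f a b l <->
  is_RInt (fun t => Re (f t)) a b (Re l) /\ is_RInt (fun t => Im (f t)) a b (Im l).
Proof.
  split.
  - intros H; split.
    + exact (is_RInt_fct_extend_fst (U:=R_NormedModule) (V:=R_NormedModule) f a b l H).
    + exact (is_RInt_fct_extend_snd (U:=R_NormedModule) (V:=R_NormedModule) f a b l H).
  - intros [H1 H2]; destruct l as [l1 l2].
    exact (is_RInt_fct_extend_pair (U:=R_NormedModule) (V:=R_NormedModule) f a b l1 l2 H1 H2).
Qed.

Lemma is_derive_CC_horizontal (f : C -> C) (x y : R) (l : C) :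
  is_derive_CC f (x, y) l -> is_derive_RC (fun x => f (x, y)) x l.
Proof.
  intros H; evar_last; [apply (is_derive_CC_path f (fun x => (x, y)) x l 1%C H) | apply Cmult_1_r].
  apply is_derive_C_R_iff; split; simpl; auto_derive; auto.
Qed.

Lemma is_derive_CC_vertical (f : C -> C) (x y : R) (l : C) :
  is_derive_CC f (x, y) l -> is_derive_RC (fun y => f (x, y)) y (l * Ci)%C.
Proof.
  intros H; apply (is_derive_CC_path f (fun y => (x, y)) y l Ci H).
  apply is_derive_C_R_iff; split; simpl; auto_derive; auto.
Qed.

Lemma ex_RInt_horizontal (D : C -> Prop) (f : C -> C) (a b y : R) : holomorphic_on D f ->
  a <= b -> (forall u, a <= u <= b -> D (u, y)) -> ex_RIntC (fun u => f (u, y)) a b.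
Proof.
  intros [f' Hf] Hab HD; apply (ex_RInt_continuous (V:=C_R_CompleteNormedModule)); intros u Hu.
  rewrite Rmin_left, Rmax_right in Hu by lra.
  apply (ex_derive_continuous (V:=C_R_NormedModule)); exists (f' (u, y)).
  apply is_derive_CC_horizontal, Hf, HD, Hu.
Qed.

Definition open_rectangle (a b c d : R) (z : C) : Prop := a < Re z < b /\ c < Im z < d.

Section HorizontalSegments.

Variables a0 a b b0 c0 d0 : R.
Hypotheses (Ha : a0 < a) (Hab : a <= b) (Hb : b < b0).

Lemma is_derive_RInt_conjugate (phi psi g : R -> R -> R) (y : R) :
  (forall y u, c0 < y < d0 -> a0 < u < b0 -> is_derive (fun y => phi y u) y (g y u)) ->
  (forall y u, c0 < y < d0 -> a0 < u < b0 -> is_derive (psi y) u (g y u)) ->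
  (forall y u, c0 < y < d0 -> a0 < u < b0 -> continuity_2d_pt g y u) ->
  (forall y u, c0 < y < d0 -> a0 < u < b0 -> continuous (phi y) u) ->
  c0 < y < d0 -> is_derive (fun y => RInt (phi y) a b) y (psi y b - psi y a).
Proof.
  intros Dphi Dpsi Cg Cphi Hy.
  assert (Hloc : locally y (fun y => c0 < y < d0))
    by (apply (open_and _ _ (open_gt c0) (open_lt d0)); exact Hy).
  evar_last; [apply is_derive_RInt_param |].
  - revert Hloc; apply filter_imp; intros x Hx u Hu; rewrite Rmin_left, Rmax_right in Hu by lra.
    eexists; apply Dphi; lra.
  - intros u Hu; rewrite Rmin_left, Rmax_right in Hu by lra.
    apply (continuity_2d_pt_ext_loc g); [| apply Cg; lra].
    assert (Hu' : locally u (fun u => a0 < u < b0))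
      by (apply (open_and _ _ (open_gt a0) (open_lt b0)); simpl; lra).
    destruct Hloc as [d1 Hd1], Hu' as [d2 Hd2].
    exists (mkposreal _ (Rmin_stable_in_posreal d1 d2)); simpl; intros x v Hx Hv.
    symmetry; apply is_derive_unique, Dphi.
    + apply Hd1, (Rlt_le_trans _ _ _ Hx), Rmin_l.
    + apply Hd2, (Rlt_le_trans _ _ _ Hv), Rmin_r.
  - revert Hloc; apply filter_imp; intros x Hx.
    apply (ex_RInt_continuous (V:=R_CompleteNormedModule)).
    intros u Hu; rewrite Rmin_left, Rmax_right in Hu by lra; apply Cphi; lra.
  - apply is_RInt_unique, (is_RInt_ext (g y)).
    + intros u Hu; rewrite Rmin_left, Rmax_right in Hu by lra.
      symmetry; apply is_derive_unique, Dphi; lra.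
    + apply (is_RInt_derive (V:=R_CompleteNormedModule) (psi y) (g y));
        intros u Hu; rewrite Rmin_left, Rmax_right in Hu by lra.
      * apply Dpsi; lra.
      * apply continuity_2d_pt_continuous_snd, Cg; lra.
Qed.

Lemma is_derive_horizontal_RInt_Re (f : C -> C) (y : R) :
  holomorphic_on (open_rectangle a0 b0 c0 d0) f -> c0 < y < d0 ->
  is_derive (fun y => RInt (fun u => Re (f (u, y))) a b) y (Im (f (a, y)) - Im (f (b, y))).
Proof.
  intros [f' Hf] Hy.
  assert (D : forall v u, c0 < v < d0 -> a0 < u < b0 -> is_derive_CC f (u, v) (f' (u, v))).
  { intros v u Hv Hu; apply Hf; split; assumption. }
  evar_last; [apply (is_derive_RInt_conjugate (fun y u => Re (f (u, y)))
    (fun y u => - Im (f (u, y))) (fun y u => - Im (f' (u, y)))); [.. | exact Hy] |].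
  - intros v u Hv Hu; evar_last.
    + exact (proj1 (proj1 (is_derive_C_R_iff _ _ _) (is_derive_CC_vertical f u v _ (D v u Hv Hu)))).
    + unfold Re, Im; simpl; ring.
  - intros v u Hv Hu; apply (is_derive_opp (V:=R_NormedModule)).
    exact (proj2 (proj1 (is_derive_C_R_iff _ _ _) (is_derive_CC_horizontal f u v _ (D v u Hv Hu)))).
  - intros v u Hv Hu; apply continuity_2d_pt_opp, continuous_CC_continuity_2d, Hf.
    split; assumption.
  - intros v u Hv Hu; apply (ex_derive_continuous (V:=R_NormedModule)); eexists.
    exact (proj1 (proj1 (is_derive_C_R_iff _ _ _) (is_derive_CC_horizontal f u v _ (D v u Hv Hu)))).
  - simpl; ring.
Qed.

(* Cauchy's theorem for a rectangle, differentiated in the height of its upper side. *)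
Lemma is_derive_horizontal_RInt (f : C -> C) (y : R) :
  holomorphic_on (open_rectangle a0 b0 c0 d0) f -> c0 < y < d0 ->
  is_derive_RC (fun y => RIntC (fun u => f (u, y)) a b) y (Ci * (f (b, y) - f (a, y)))%C.
Proof.
  intros Hf Hy.
  assert (Hex : locally y (fun y =>
    is_RIntC (fun u => f (u, y)) a b (RIntC (fun u => f (u, y)) a b))).
  { generalize (open_and _ _ (open_gt c0) (open_lt d0) y Hy).
    apply filter_imp; intros v Hv; apply (RInt_correct (V:=C_R_CompleteNormedModule)).
    apply (ex_RInt_horizontal _ f a b v Hf Hab); intros u Hu; split; simpl; lra. }
  apply is_derive_C_R_iff; split.
  - apply (is_derive_ext_loc (fun y => RInt (fun u => Re (f (u, y))) a b)).
    { revert Hex; apply filter_imp; intros v Hv; apply is_RInt_unique.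
      exact (proj1 (proj1 (is_RInt_C_R_iff _ _ _ _) Hv)). }
    evar_last; [apply is_derive_horizontal_RInt_Re; [exact Hf | exact Hy] |].
    unfold Re, Im; simpl; ring.
  - apply (is_derive_ext_loc (fun y => RInt (fun u => Re (- Ci * f (u, y))%C) a b)).
    { revert Hex; apply filter_imp; intros v Hv; apply is_RInt_unique.
      apply (is_RInt_ext (fun u => Im (f (u, v)))); [intros u _; unfold Re, Im; simpl; ring |].
      exact (proj2 (proj1 (is_RInt_C_R_iff _ _ _ _) Hv)). }
    evar_last; [apply (is_derive_horizontal_RInt_Re (fun z => - Ci * f z)%C); [| exact Hy] |].
    + apply holomorphic_on_mult; [apply holomorphic_on_const | exact Hf].
    + unfold Re, Im; simpl; ring.
Qed.

Lemma Cmod_horizontal_RInt_minus_le (f : C -> C) (M y1 y2 : R) :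
  holomorphic_on (open_rectangle a0 b0 c0 d0) f ->
  c0 < y1 < d0 -> c0 < y2 < d0 ->
  (forall y, Rmin y1 y2 <= y <= Rmax y1 y2 -> Cmod (f (a, y)) <= M /\ Cmod (f (b, y)) <= M) ->
  Cmod (RIntC (fun u => f (u, y2)) a b - RIntC (fun u => f (u, y1)) a b)%C
  <= 2 * M * Rabs (y2 - y1).
Proof.
  intros Hf H1 H2 HM.
  apply (Cmod_mean_value_le (fun y => RIntC (fun u => f (u, y)) a b)
           (fun y => Ci * (f (b, y) - f (a, y)))%C).
  intros y Hy; split.
  - apply is_derive_horizontal_RInt; [exact Hf |].
    assert (c0 < Rmin y1 y2) by (apply Rmin_glb_lt; lra).
    assert (Rmax y1 y2 < d0) by (apply Rmax_lub_lt; lra); lra.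
  - destruct (HM y Hy); rewrite Cmod_mult, Cmod_Ci, Rmult_1_l.
    eapply Rle_trans; [apply Cmod_triangle |]; rewrite Cmod_opp; lra.
Qed.

End HorizontalSegments.

(** * Uniform limits and improper integrals *)

Definition cvg_unif {T : Type} (P : T -> Prop) (fn : nat -> T -> C) (f : T -> C) : Prop :=
  forall eps, 0 < eps -> eventually (fun n => forall x, P x -> Cmod (fn n x - f x)%C < eps).

Definition unif_bounded {T : Type} (P : T -> Prop) (fn : nat -> T -> C) : Prop :=
  exists M, forall n x, P x -> Cmod (fn n x) <= M.

Section UniformLimits.

Context {T : Type} (P : T -> Prop).
Implicit Types (fn gn : nat -> T -> C) (f g : T -> C).

Lemma cvg_unif_rate fn f (e : nat -> R) : is_lim_seq e 0 ->
  eventually (fun n => forall x, P x -> Cmod (fn n x - f x)%C <= e n) -> cvg_unif P fn f.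
Proof.
  intros He H eps Heps.
  apply is_lim_seq_spec in He.
  generalize (filter_and (F:=eventually) _ _ H (He (mkposreal eps Heps))); apply filter_imp;
    intros n [Hn Hen] x Hx; simpl in Hen; rewrite Rminus_0_r in Hen.
  eapply Rle_lt_trans; [apply Hn, Hx |]; eapply Rle_lt_trans; [apply Rle_abs | exact Hen].
Qed.

Lemma cvg_unif_const f : cvg_unif P (fun _ => f) f.
Proof.
  intros eps Heps; apply filter_forall; intros n x _.
  unfold Cminus; rewrite Cplus_opp_r, Cmod_0; exact Heps.
Qed.

Lemma cvg_unif_incr_1 fn f : cvg_unif P fn f -> cvg_unif P (fun n => fn (S n)) f.
Proof.
  intros H eps Heps; destruct (H eps Heps) as [N HN]; exists N; intros n Hn.
  apply HN; lia.
Qed.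

Lemma cvg_unif_lipschitz fn f gn g (K : R) : 0 < K ->
  (forall n x, P x -> Cmod (gn n x - g x)%C <= K * Cmod (fn n x - f x)%C) ->
  cvg_unif P fn f -> cvg_unif P gn g.
Proof.
  intros HK Hle H eps Heps; generalize (H (eps / K) (Rdiv_lt_0_compat _ _ Heps HK)).
  apply filter_imp; intros n Hn x Hx; specialize (Hn x Hx).
  apply Rlt_div_r in Hn; [| exact HK].
  eapply Rle_lt_trans; [apply Hle, Hx | lra].
Qed.

Lemma cvg_unif_minus fn f gn g : cvg_unif P fn f -> cvg_unif P gn g ->
  cvg_unif P (fun n x => fn n x - gn n x)%C (fun x => f x - g x)%C.
Proof.
  intros Hf Hg eps Heps.
  generalize (filter_and (F:=eventually) _ _ (Hf (eps / 2) ltac:(lra)) (Hg (eps / 2) ltac:(lra))).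
  apply filter_imp; intros n [Hfn Hgn] x Hx; specialize (Hfn x Hx); specialize (Hgn x Hx).
  replace (fn n x - gn n x - (f x - g x))%C with ((fn n x - f x) + - (gn n x - g x))%C by ring.
  eapply Rle_lt_trans; [apply Cmod_triangle |]; rewrite Cmod_opp; lra.
Qed.

Lemma cvg_unif_Cmod_le fn f (x : T) (M : R) :
  cvg_unif P fn f -> P x -> (forall n, Cmod (fn n x) <= M) -> Cmod (f x) <= M.
Proof.
  intros H Hx HM; apply le_epsilon; intros eps Heps.
  destruct (H eps Heps) as [N HN]; specialize (HN N (le_n N) x Hx).
  replace (f x) with (fn N x + - (fn N x - f x))%C by ring.
  eapply Rle_trans; [apply Cmod_triangle |]; rewrite Cmod_opp; specialize (HM N); lra.
Qed.

Lemma unif_bounded_mult fn gn : unif_bounded P fn -> unif_bounded P gn ->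
  unif_bounded P (fun n x => fn n x * gn n x)%C.
Proof.
  intros [A HA] [B HB]; exists (A * B); intros n x Hx; rewrite Cmod_mult.
  apply Rmult_le_compat; auto using Cmod_ge_0.
Qed.

Lemma unif_bounded_gt0 fn :
  unif_bounded P fn -> exists M, 0 < M /\ forall n x, P x -> Cmod (fn n x) <= M.
Proof.
  intros [M HM]; exists (Rmax M 1); split; [eapply Rlt_le_trans; [apply Rlt_0_1 | apply Rmax_r] |].
  intros n x Hx; eapply Rle_trans; [apply HM, Hx | apply Rmax_l].
Qed.

Lemma cvg_unif_mult fn f gn g : unif_bounded P fn -> unif_bounded P gn ->
  cvg_unif P fn f -> cvg_unif P gn g ->
  cvg_unif P (fun n x => fn n x * gn n x)%C (fun x => f x * g x)%C.
Proof.
  intros HA HB Hf Hg eps Heps.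
  apply unif_bounded_gt0 in HA as (A & HA0 & HA); apply unif_bounded_gt0 in HB as (B & HB0 & HB).
  assert (HgB : forall x, P x -> Cmod (g x) <= B)
    by (intros x Hx; apply (cvg_unif_Cmod_le gn g x B Hg Hx); auto).
  pose (delta := eps / (A + B)).
  assert (Hdelta : 0 < delta) by (apply Rdiv_lt_0_compat; lra).
  generalize (filter_and (F:=eventually) _ _ (Hf delta Hdelta) (Hg delta Hdelta)).
  apply filter_imp; intros n [Hfn Hgn] x Hx; specialize (Hfn x Hx); specialize (Hgn x Hx).
  replace (fn n x * gn n x - f x * g x)%C
    with (fn n x * (gn n x - g x) + (fn n x - f x) * g x)%C by ring.
  eapply Rle_lt_trans; [apply Cmod_triangle |]; rewrite !Cmod_mult.
  replace eps with (A * delta + delta * B) by (unfold delta; field; lra).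
  apply Rplus_lt_le_compat.
  - apply Rle_lt_trans with (A * Cmod (gn n x - g x)%C); [| apply Rmult_lt_compat_l; assumption].
    apply Rmult_le_compat_r; auto using Cmod_ge_0.
  - apply Rmult_le_compat; auto using Cmod_ge_0, Rlt_le.
Qed.

End UniformLimits.

Lemma cvg_unif_comp {T U : Type} (P : T -> Prop) (Q : U -> Prop) (fn : nat -> U -> C)
  (f : U -> C) (h : T -> U) : (forall x, P x -> Q (h x)) ->
  cvg_unif Q fn f -> cvg_unif P (fun n x => fn n (h x)) (fun x => f (h x)).
Proof.
  intros HPQ H eps Heps; generalize (H eps Heps); apply filter_imp; intros n Hn x Hx.
  apply Hn, HPQ, Hx.
Qed.

Lemma cvg_unif_RInt (fn : nat -> R -> C) (f : R -> C) (a b : R) : a <= b ->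
  (forall n, ex_RIntC (fn n) a b) -> cvg_unif (fun u => a <= u <= b) fn f ->
  ex_RIntC f a b /\
  filterlim (fun n => RIntC (fn n) a b) eventually (@locally C_R_NormedModule (RIntC f a b)).
Proof.
  intros Hab Hex Hcvg.
  pose (cut (g : R -> C) (u : R) :=
    if Rle_dec a u then if Rle_dec u b then g u else RtoC 0 else RtoC 0).
  assert (Hcut : forall (g : R -> C) u, Rmin a b < u < Rmax a b -> cut g u = g u).
  { intros g u Hu; rewrite Rmin_left, Rmax_right in Hu by lra; unfold cut.
    destruct (Rle_dec a u); [destruct (Rle_dec u b); [reflexivity |] |]; lra. }
  destruct (filterlim_RInt (V:=C_R_CompleteNormedModule) (fun n => cut (fn n)) a b eventually _
    (cut f) (fun n => RIntC (fn n) a b)) as (I & HI & HIf).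
  - intros n; apply (is_RInt_ext (V:=C_R_NormedModule) (fn n)).
    + intros u Hu; symmetry; apply Hcut, Hu.
    + apply (RInt_correct (V:=C_R_CompleteNormedModule)), Hex.
  - apply filterlim_locally; intros eps; generalize (Hcvg eps (cond_pos eps)).
    apply filter_imp; intros n Hn u; unfold cut.
    destruct (Rle_dec a u); [destruct (Rle_dec u b) |]; try apply ball_center.
    apply C_NormedModule_mixin_compat1, Hn; split; assumption.
  - assert (Hf : is_RIntC f a b I)
      by (apply (is_RInt_ext (V:=C_R_NormedModule) (cut f) f _ _ _ (Hcut f)), HIf).
    split; [exists I; exact Hf |].
    rewrite (is_RInt_unique (V:=C_R_CompleteNormedModule) _ _ _ _ Hf); exact HI.
Qed.

Lemma Cmod_horizontal_RInt_minus_le_lim (a0 a b b0 c0 d0 : R) (fn : nat -> C -> C) (f : C -> C)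
  (M y1 y2 : R) :
  a0 < a -> a <= b -> b < b0 -> c0 < y1 < d0 -> c0 < y2 < d0 ->
  (forall n, holomorphic_on (open_rectangle a0 b0 c0 d0) (fn n)) ->
  (forall n y, Rmin y1 y2 <= y <= Rmax y1 y2 ->
     Cmod (fn n (a, y)) <= M /\ Cmod (fn n (b, y)) <= M) ->
  cvg_unif (fun u => a <= u <= b) (fun n u => fn n (u, y1)) (fun u => f (u, y1)) ->
  cvg_unif (fun u => a <= u <= b) (fun n u => fn n (u, y2)) (fun u => f (u, y2)) ->
  Cmod (RIntC (fun u => f (u, y2)) a b - RIntC (fun u => f (u, y1)) a b)%C
  <= 2 * M * Rabs (y2 - y1).
Proof.
  intros Ha Hab Hb H1 H2 Hfn HM C1 C2.
  assert (Hex : forall n y, c0 < y < d0 -> ex_RIntC (fun u => fn n (u, y)) a b).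
  { intros n y Hy; apply (ex_RInt_horizontal _ (fn n) a b y (Hfn n) Hab).
    intros u Hu; split; simpl; lra. }
  destruct (cvg_unif_RInt _ _ a b Hab (fun n => Hex n y1 H1) C1) as [_ L1].
  destruct (cvg_unif_RInt _ _ a b Hab (fun n => Hex n y2 H2) C2) as [_ L2].
  assert (L := filterlim_comp_2 _ _ _ L2 (filterlim_comp _ _ _ _ _ _ _ _ L1 (filterlim_opp _))
    (filterlim_plus (V:=C_R_NormedModule) _ _)).
  apply (filterlim_comp _ _ _ _ norm _ _ _) with (2 := filterlim_norm _) in L.
  rewrite <- norm_C_R.
  refine (is_lim_seq_le _ _ (Finite _) (Finite _) _ L (is_lim_seq_const _)).
  intros n; cbv beta; rewrite norm_C_R.
  apply (Cmod_horizontal_RInt_minus_le a0 a b b0 c0 d0); auto.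
Qed.

Lemma RIntC_Chasles (f : R -> C) (a b c : R) : ex_RIntC f a b -> ex_RIntC f b c ->
  RIntC f a c = (RIntC f a b + RIntC f b c)%C.
Proof. intros H K; symmetry; exact (RInt_Chasles (V:=C_R_CompleteNormedModule) f a b c H K). Qed.

Lemma Cmod_RInt_le_primitive (f : R -> C) (G g : R -> R) (a b : R) : a <= b -> ex_RIntC f a b ->
  (forall u, a <= u <= b -> is_derive G u (g u)) ->
  (forall u, a <= u <= b -> continuous g u) ->
  (forall u, a <= u <= b -> Cmod (f u) <= g u) ->
  Cmod (RIntC f a b) <= G b - G a.
Proof.
  intros Hab Hex HG Hg Hf; rewrite <- norm_C_R.
  apply (norm_RInt_le (V:=C_R_NormedModule) f g a b); [exact Hab | | |].
  - intros u Hu; rewrite norm_C_R; apply Hf, Hu.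
  - apply (RInt_correct (V:=C_R_CompleteNormedModule)), Hex.
  - apply (is_RInt_derive (V:=R_CompleteNormedModule) G g);
      intros u Hu; rewrite Rmin_left, Rmax_right in Hu by lra; [apply HG | apply Hg]; exact Hu.
Qed.

Section ImproperIntegrals.

Context (f : R -> C) (Fa Fb : (R -> Prop) -> Prop) {PFa : ProperFilter Fa} {PFb : ProperFilter Fb}.
Hypothesis Hex : filter_prod Fa Fb (fun ab => ex_RIntC f (fst ab) (snd ab)).

Lemma ex_RInt_gen_cauchy :
  (forall eps : posreal, exists c : C,
     filter_prod Fa Fb (fun ab => Cmod (RIntC f (fst ab) (snd ab) - c)%C < eps)) ->
  @ex_RInt_gen C_R_NormedModule f Fa Fb.
Proof.
  intros Hc.
  apply (filterlimi_locally_cauchy (U:=C_R_CompleteNormedModule) (F:=filter_prod Fa Fb)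
     (fun ab => is_RIntC f (fst ab) (snd ab))).
  - revert Hex; apply filter_imp; intros ab H; split; [exact H |].
    intros y1 y2 H1 H2; apply (is_RInt_unique (V:=C_R_CompleteNormedModule)) in H1, H2; congruence.
  - intros eps; destruct (Hc (pos_div_2 eps)) as [c Hcc].
    eexists; split; [exact Hcc |]; simpl; intros u v Hu Hv u' v' Iu Iv.
    apply (is_RInt_unique (V:=C_R_CompleteNormedModule)) in Iu, Iv.
    rewrite Iu in Hu; rewrite Iv in Hv.
    apply C_NormedModule_mixin_compat1; change (Cmod (v' - u')%C < eps).
    replace (v' - u')%C with ((v' - c) + - (u' - c))%C by ring.
    eapply Rle_lt_trans; [apply Cmod_triangle |]; rewrite Cmod_opp; lra.
Qed.

Lemma Cmod_RInt_gen_minus_le (c : C) (M : R) :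
  @ex_RInt_gen C_R_NormedModule f Fa Fb ->
  filter_prod Fa Fb (fun ab => Cmod (RIntC f (fst ab) (snd ab) - c)%C <= M) ->
  Cmod (@RInt_gen C_R_CompleteNormedModule f Fa Fb - c)%C <= M.
Proof.
  intros Hgen HM; apply le_epsilon; intros eps Heps.
  assert (Hlim := RInt_gen_correct (V:=C_R_CompleteNormedModule) f Hgen).
  set (l := RInt_gen _ _ _) in *.
  assert (He2 : 0 < eps / 2) by lra.
  assert (Hb := proj1 (filterlimi_locally (U:=C_R_CompleteNormedModule) _ l) Hlim
    (mkposreal _ He2)).
  destruct (filter_ex _ (filter_and _ _ Hb HM)) as (ab & (z & Iz & Bz) & Hz).
  rewrite (is_RInt_unique (V:=C_R_CompleteNormedModule) _ _ _ _ Iz) in Hz.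
  apply C_NormedModule_mixin_compat2 in Bz.
  change (Cmod (z - l)%C < sqrt 2 * (eps / 2)) in Bz.
  assert (Hs2 : sqrt 2 <= 2) by (apply Rsqr_incr_0_var; [unfold Rsqr; rewrite sqrt_sqrt |]; lra).
  replace (l - c)%C with ((z - c) + - (z - l))%C by ring.
  eapply Rle_trans; [apply Cmod_triangle |]; rewrite Cmod_opp; nra.
Qed.

End ImproperIntegrals.

(** * Complex powers *)

Lemma exp_le (x y : R) : x <= y -> exp x <= exp y.
Proof. intros [H | ->]; [left; apply exp_increasing, H | right; reflexivity]. Qed.

Lemma is_lim_exp_opp_mult_ln (r : R) : 0 < r -> is_lim (fun x => exp (- (r * ln x))) p_infty 0.
Proof.
  intros Hr; apply (is_lim_comp exp (fun x => - (r * ln x)) p_infty 0 m_infty).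
  - apply is_lim_exp_m.
  - evar_last; [apply is_lim_opp, is_lim_scal_l, is_lim_ln_p |].
    simpl; destruct (Rle_dec 0 r); [| lra]; destruct (Rle_lt_or_eq_dec 0 r r0); [reflexivity | lra].
  - exists 0; discriminate.
Qed.

Lemma exists_exp_opp_mult_ln_lt (r eps B : R) : 0 < r -> 0 < eps ->
  exists A, B < A /\ exp (- (r * ln A)) < eps.
Proof.
  intros Hr Heps; assert (Hlim := is_lim_exp_opp_mult_ln r Hr); apply is_lim_spec in Hlim.
  destruct (filter_ex _ (filter_and (F:=Rbar_locally p_infty) _ _ (Hlim (mkposreal _ Heps))
    (ex_intro _ B (fun x Hx => Hx)))) as (A & HA & HB).
  simpl in HA; rewrite Rminus_0_r, Rabs_pos_eq in HA by (left; apply exp_pos).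
  exists A; split; assumption.
Qed.

Lemma cexp_plus (z w : C) : cexp (z + w)%C = (cexp z * cexp w)%C.
Proof.
  apply injective_projections; unfold cexp; simpl; fold (Re z) (Re w) (Im z) (Im w);
    rewrite exp_plus.
  - rewrite cos_plus; ring.
  - rewrite sin_plus; ring.
Qed.

Lemma Cmod_cexp (z : C) : Cmod (cexp z) = exp (Re z).
Proof.
  unfold Cmod, cexp; simpl fst; simpl snd.
  replace (_ + _) with (Rsqr (exp (Re z))); [apply sqrt_Rsqr, Rlt_le, exp_pos |].
  pose proof (sin2_cos2 (Im z)); unfold Rsqr in *; nra.
Qed.

Lemma Cmod_rpowC (x : R) (s : C) : Cmod (rpowC x s) = exp (Re s * ln x).
Proof. unfold rpowC; rewrite Cmod_cexp; f_equal; simpl; unfold Re; ring. Qed.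

Lemma rpowC_pred (x : R) (s : C) : 0 < x -> (RtoC x * rpowC x (s - 1))%C = rpowC x s.
Proof.
  intros Hx; unfold rpowC.
  replace (s * RtoC (ln x))%C with (RtoC (ln x) + (s - 1) * RtoC (ln x))%C by ring.
  rewrite cexp_plus; f_equal.
  apply injective_projections; simpl; rewrite exp_ln, ?cos_0, ?sin_0 by assumption; ring.
Qed.

Lemma is_derive_RC_Cmult_l (c : C) (f : R -> C) (x : R) (l : C) :
  is_derive_RC f x l -> is_derive_RC (fun x => c * f x)%C x (c * l)%C.
Proof.
  intros H; apply (is_derive_CC_path (fun z => c * z)%C f x c l); [| exact H].
  evar_last; [exact (is_derive_mult (K:=C_AbsRing) _ _ (f x) _ _
    (@is_derive_const C_AbsRing C_selfModule c (f x)) (is_derive_id (K:=C_AbsRing) (f x))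
    Cmult_comm) |].
  unfold plus, mult, zero, one; simpl; ring.
Qed.

Lemma is_derive_rpowC (s : C) (x : R) : 0 < x ->
  is_derive_RC (fun x => rpowC x s) x (s * rpowC x (s - 1))%C.
Proof.
  intros Hx; evar_last.
  - apply (is_derive_CC_path cexp (fun x => s * RtoC (ln x))%C x (rpowC x s) (s * RtoC (/ x))%C).
    + apply is_derive_cexp.
    + apply is_derive_C_R_iff; split; simpl; auto_derive; auto; field; lra.
  - rewrite <- (rpowC_pred x s Hx).
    transitivity (s * (RtoC x * RtoC (/ x)) * rpowC x (s - 1))%C; [ring |].
    rewrite <- RtoC_mult, Rinv_r by lra; ring.
Qed.

Lemma holomorphic_on_rpowC (D : C -> Prop) (x : R) (f : C -> C) :
  holomorphic_on D f -> holomorphic_on D (fun z => rpowC x (f z)).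
Proof.
  intros Hf; apply holomorphic_on_cexp, holomorphic_on_mult;
    [exact Hf | apply holomorphic_on_const].
Qed.

(** * Truncating the integral of zeta *)

Definition zeta_integrand (s : C) (x : R) : C := (RtoC (frac_part x) * rpowC x (- s - RtoC 1))%C.

(* An antiderivative of [x |-> (x - k) * x ^ (- s - 1)], the integrand on [[k, k + 1]]. *)
Definition zeta_primitive (k : R) (s : C) (x : R) : C :=
  (rpowC x (1 - s) / (1 - s) + RtoC k / s * rpowC x (- s))%C.

Definition zeta_integral (N : nat) (s : C) : C :=
  sum_n (fun k => zeta_primitive (INR (S k)) s (INR (S (S k)))
                  - zeta_primitive (INR (S k)) s (INR (S k)))%C N.

Definition zeta_trunc (N : nat) (s : C) : C := (s / (s - RtoC 1) - s * zeta_integral N s)%C.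

Lemma holomorphic_on_zeta_trunc (D : C -> Prop) (N : nat) (f : C -> C) :
  (forall z, D z -> f z <> 0%C) -> (forall z, D z -> f z <> 1%C) ->
  holomorphic_on D f -> holomorphic_on D (fun z => zeta_trunc N (f z)).
Proof.
  intros H0 H1 Hf.
  assert (P : forall k x, holomorphic_on D (fun z => zeta_primitive k (f z) x)).
  { intros k x; apply holomorphic_on_plus.
    - apply holomorphic_on_div.
      + intros z Hz; apply Cminus_eq_contra, not_eq_sym, H1, Hz.
      + apply holomorphic_on_rpowC, holomorphic_on_minus; [apply holomorphic_on_const | exact Hf].
      + apply holomorphic_on_minus; [apply holomorphic_on_const | exact Hf].
    - apply holomorphic_on_mult; [| apply holomorphic_on_rpowC, holomorphic_on_opp, Hf].
      apply holomorphic_on_div; [exact H0 | apply holomorphic_on_const | exact Hf]. }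
  apply holomorphic_on_minus.
  - apply holomorphic_on_div; [intros z Hz; apply Cminus_eq_contra, H1, Hz | exact Hf |].
    apply holomorphic_on_minus; [exact Hf | apply holomorphic_on_const].
  - apply holomorphic_on_mult; [exact Hf |].
    apply (holomorphic_on_sum_n D (fun k z => zeta_primitive (INR (S k)) (f z) (INR (S (S k)))
             - zeta_primitive (INR (S k)) (f z) (INR (S k)))%C).
    intros k; apply holomorphic_on_minus; apply P.
Qed.

Section ZetaIntegral.

Variable s : C.
Hypotheses (Hs : 0 < Re s) (Hs1 : s <> 1%C).

Lemma is_derive_zeta_primitive (k x : R) : 0 < x ->
  is_derive_RC (zeta_primitive k s) x (RtoC (x - k) * rpowC x (- s - RtoC 1))%C.
Proof.
  intros Hx; assert (H0 := slit_plane_neq0 s (or_introl Hs)).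
  assert (H1 : (1 - s)%C <> 0%C) by (apply Cminus_eq_contra, not_eq_sym, Hs1).
  evar_last.
  - apply (is_derive_ext (V:=C_R_NormedModule)
      (fun x => (/ (1 - s) * rpowC x (1 - s) + RtoC k / s * rpowC x (- s))%C)).
    { intros r; unfold zeta_primitive, Cdiv; eq_in_C; ring. }
    apply is_derive_RC_plus; apply is_derive_RC_Cmult_l, is_derive_rpowC, Hx.
  - replace (1 - s - 1)%C with (- s)%C by ring.
    rewrite <- (rpowC_pred x (- s) Hx) at 1; rewrite RtoC_minus.
    field; split; assumption.
Qed.

Lemma is_RInt_zeta_integrand_unit (k : nat) : (1 <= k)%nat ->
  is_RIntC (zeta_integrand s) (INR k) (INR (S k))
    (zeta_primitive (INR k) s (INR (S k)) - zeta_primitive (INR k) s (INR k))%C.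
Proof.
  intros Hk; apply le_INR in Hk; simpl in Hk; rewrite S_INR.
  apply (is_RInt_ext (V:=C_R_NormedModule) (fun x => RtoC (x - INR k) * rpowC x (- s - RtoC 1))%C).
  - intros x Hx; rewrite Rmin_left, Rmax_right in Hx by lra.
    unfold zeta_integrand; do 2 f_equal.
    apply (Int_part_frac_part_spec x (Z.of_nat k)); [lra | rewrite <- INR_IZR_INZ; ring].
  - apply (is_RInt_derive (V:=C_R_CompleteNormedModule)); intros x Hx;
      rewrite Rmin_left, Rmax_right in Hx by lra; [apply is_derive_zeta_primitive; lra |].
    apply (continuous_ext (fun x => scal (x - INR k) (rpowC x (- s - RtoC 1) : C_R_NormedModule)));
      [intros r; apply scal_C_R |].
    apply (continuous_scal (V:=C_R_NormedModule) (fun x => x - INR k)).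
    + apply (ex_derive_continuous (V:=R_NormedModule)); auto_derive; auto.
    + apply (ex_derive_continuous (V:=C_R_NormedModule)); eexists; apply is_derive_rpowC; lra.
Qed.

Lemma is_RInt_zeta_integrand (N : nat) :
  is_RIntC (zeta_integrand s) 1 (INR (S (S N))) (zeta_integral N s).
Proof.
  unfold zeta_integral; induction N as [|N IH].
  - rewrite sum_O; apply (is_RInt_zeta_integrand_unit 1), le_n.
  - rewrite sum_Sn; apply (is_RInt_Chasles (V:=C_R_NormedModule) _ _ (INR (S (S N)))); [exact IH |].
    apply is_RInt_zeta_integrand_unit; lia.
Qed.

Lemma ex_RInt_zeta_integrand (A B : R) : 1 <= A -> 1 <= B -> ex_RIntC (zeta_integrand s) A B.
Proof.
  assert (H1 : forall B, 1 <= B -> ex_RIntC (zeta_integrand s) 1 B).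
  { clear B; intros B HB; destruct (INR_unbounded B) as [N HN].
    apply (ex_RInt_Chasles_1 (V:=C_R_CompleteNormedModule) _ 1 B (INR (S (S N)))).
    - rewrite !S_INR; lra.
    - eexists; apply is_RInt_zeta_integrand. }
  intros HA HB; apply (ex_RInt_Chasles (V:=C_R_NormedModule) _ A 1 B); [apply ex_RInt_swap |]; auto.
Qed.

Lemma Cmod_RInt_zeta_integrand_le (A B : R) : 1 <= A <= B ->
  Cmod (RIntC (zeta_integrand s) A B) <= exp (- (Re s * ln A)) / Re s.
Proof.
  intros HAB.
  apply Rle_trans with (- exp (- (Re s * ln B)) / Re s - - exp (- (Re s * ln A)) / Re s).
  2:{ pose proof (exp_pos (- (Re s * ln B))).
      assert (0 < exp (- (Re s * ln B)) / Re s) by (apply Rdiv_lt_0_compat; assumption); lra. }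
  apply (Cmod_RInt_le_primitive _ (fun x => - exp (- (Re s * ln x)) / Re s)
           (fun x => exp (- ((Re s + 1) * ln x)))).
  - apply HAB.
  - apply ex_RInt_zeta_integrand; lra.
  - intros x Hx; auto_derive; [lra |].
    replace (- ((Re s + 1) * ln x)) with (- (Re s * ln x) + - ln x) by ring.
    rewrite exp_plus, (exp_Ropp (ln x)), exp_ln by lra; field; lra.
  - intros x Hx; apply (ex_derive_continuous (V:=R_NormedModule)); auto_derive; lra.
  - intros x Hx; unfold zeta_integrand; rewrite Cmod_mult, Cmod_rpowC, Cmod_R.
    destruct (base_fp x) as [F1 F2]; rewrite Rabs_pos_eq by lra.
    replace (Re (- s - RtoC 1)%C * ln x) with (- ((Re s + 1) * ln x)) by (unfold Re; simpl; ring).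
    pose proof (exp_pos (- ((Re s + 1) * ln x))); nra.
Qed.

Lemma Cmod_RInt_zeta_integrand_minus_le (A B : R) : 1 <= A <= B ->
  Cmod (RIntC (zeta_integrand s) 1 B - RIntC (zeta_integrand s) 1 A)%C
  <= exp (- (Re s * ln A)) / Re s.
Proof.
  intros HAB; rewrite (RIntC_Chasles _ 1 A B) by (apply ex_RInt_zeta_integrand; lra).
  replace (_ - _)%C with (RIntC (zeta_integrand s) A B) by (symmetry; eq_in_C; ring).
  apply Cmod_RInt_zeta_integrand_le, HAB.
Qed.

Lemma filter_prod_at_point_p_infty (a M : R) :
  filter_prod (at_point a) (Rbar_locally p_infty) (fun ab => fst ab = a /\ M < snd ab).
Proof.
  apply (Filter_prod _ _ _ (fun x => x = a) (fun y => M < y));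
    [reflexivity | exists M; auto | auto].
Qed.

Lemma ex_RInt_gen_zeta_integrand :
  @ex_RInt_gen C_R_NormedModule (zeta_integrand s) (at_point 1) (Rbar_locally p_infty).
Proof.
  apply (ex_RInt_gen_cauchy (zeta_integrand s) (at_point 1) (Rbar_locally p_infty)).
  { generalize (filter_prod_at_point_p_infty 1 1); apply filter_imp; intros [a b] [Ea Hb].
    cbn [fst snd] in *; subst a; apply ex_RInt_zeta_integrand; lra. }
  intros eps.
  assert (Heps : 0 < eps * Re s) by (apply Rmult_lt_0_compat; [apply cond_pos | exact Hs]).
  destruct (exists_exp_opp_mult_ln_lt (Re s) (eps * Re s) 1 Hs Heps) as (A & HA1 & HA).
  exists (RIntC (zeta_integrand s) 1 A).
  generalize (filter_prod_at_point_p_infty 1 A); apply filter_imp; intros [a b] [Ea Hb];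
    cbn [fst snd] in *; subst a.
  eapply Rle_lt_trans; [apply Cmod_RInt_zeta_integrand_minus_le; lra |].
  apply Rlt_div_l; assumption.
Qed.

Lemma Cmod_RInt_gen_zeta_integrand_minus_le (N : nat) :
  Cmod (@RInt_gen C_R_CompleteNormedModule (zeta_integrand s) (at_point 1) (Rbar_locally p_infty)
        - zeta_integral N s)%C <= exp (- (Re s * ln (INR (S (S N))))) / Re s.
Proof.
  rewrite <- (is_RInt_unique (V:=C_R_CompleteNormedModule) _ _ _ _ (is_RInt_zeta_integrand N)).
  apply (Cmod_RInt_gen_minus_le (zeta_integrand s) (at_point 1) (Rbar_locally p_infty));
    [apply ex_RInt_gen_zeta_integrand |].
  generalize (filter_prod_at_point_p_infty 1 (INR (S (S N)))).
  apply filter_imp; intros [a b] [Ea Hb]; cbn [fst snd] in *; subst a.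
  apply Cmod_RInt_zeta_integrand_minus_le; split; [| lra].
  rewrite S_INR; pose proof (pos_INR (S N)); lra.
Qed.

Lemma Cmod_zeta_trunc_minus_le (N : nat) :
  Cmod (zeta_trunc N s - zeta s)%C <= Cmod s * (exp (- (Re s * ln (INR (S (S N))))) / Re s).
Proof.
  unfold zeta_trunc, zeta; fold (zeta_integrand s).
  set (I := RInt_gen _ _ _).
  replace (_ - _)%C with (s * (I - zeta_integral N s))%C by ring.
  rewrite Cmod_mult; apply Rmult_le_compat_l; [apply Cmod_ge_0 |].
  apply Cmod_RInt_gen_zeta_integrand_minus_le.
Qed.

Lemma Cmod_zeta_trunc_le (N : nat) :
  Cmod (zeta_trunc N s) <= Cmod s * (/ Cmod (s - 1)%C + / Re s).
Proof.
  unfold zeta_trunc; replace (_ - _)%C with (s * (/ (s - 1) - zeta_integral N s))%C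
    by (unfold Cdiv; ring).
  rewrite Cmod_mult; apply Rmult_le_compat_l; [apply Cmod_ge_0 |].
  eapply Rle_trans; [apply Cmod_triangle |].
  rewrite Cmod_opp, Cmod_inv by apply Cminus_eq_contra, Hs1; apply Rplus_le_compat_l.
  rewrite <- (is_RInt_unique (V:=C_R_CompleteNormedModule) _ _ _ _ (is_RInt_zeta_integrand N)).
  replace (/ Re s) with (exp (- (Re s * ln 1)) / Re s)
    by (rewrite ln_1, Rmult_0_r, Ropp_0, exp_0; unfold Rdiv; ring).
  apply Cmod_RInt_zeta_integrand_le; split; [lra |].
  rewrite S_INR; pose proof (pos_INR (S N)); lra.
Qed.

End ZetaIntegral.

Lemma zeta_trunc_cvg_unif (r M : R) : 0 < r ->
  cvg_unif (fun s => r <= Re s /\ Cmod s <= M /\ s <> 1%C) zeta_trunc zeta.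
Proof.
  intros Hr.
  apply (cvg_unif_rate _ _ _ (fun N => M * (exp (- (r * ln (INR (N + 2)))) / r))).
  - replace (Finite 0) with (Rbar_mult M (0 * / r)) by (simpl; f_equal; ring).
    apply is_lim_seq_scal_l.
    apply (is_lim_seq_scal_r (fun N => exp (- (r * ln (INR (N + 2))))) (/ r) 0).
    apply (is_lim_comp_seq (fun x => exp (- (r * ln x))) (fun N => INR (N + 2)) p_infty).
    + apply is_lim_exp_opp_mult_ln, Hr.
    + exists 0%nat; discriminate.
    + apply (is_lim_seq_incr_n INR 2), is_lim_seq_INR.
  - apply filter_forall; intros N s (Hrs & HM & Hs1).
    eapply Rle_trans; [apply Cmod_zeta_trunc_minus_le; [lra | exact Hs1] |].
    replace (INR (S (S N))) with (INR (N + 2)) by (f_equal; lia).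
    assert (HN : 0 <= ln (INR (N + 2))).
    { rewrite <- ln_1; apply ln_le; [lra |]; rewrite plus_INR; simpl; pose proof (pos_INR N); lra. }
    apply Rmult_le_compat; [apply Cmod_ge_0 | | exact HM |].
    + apply Rdiv_le_0_compat; [left; apply exp_pos | lra].
    + unfold Rdiv; apply Rmult_le_compat; [left; apply exp_pos | | |].
      * left; apply Rinv_0_lt_compat; lra.
      * apply exp_le; nra.
      * apply Rinv_le_contravar; lra.
Qed.

(** * Gauss partial sums of log Gamma *)

Lemma telescoping_cvg (v r : nat -> R) (N : nat) : is_lim_seq r 0 ->
  (forall n, (N <= n)%nat -> Rabs (v (S n) - v n) <= r n - r (S n)) ->
  exists l : R, is_lim_seq v l /\ forall n, (N <= n)%nat -> Rabs (v n - l) <= r n.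
Proof.
  intros Hr Hv.
  assert (Hsum : forall n m, (N <= n)%nat -> Rabs (v (m + n)%nat - v n) <= r n - r (m + n)%nat).
  { intros n m Hn; induction m as [|m IH]; simpl.
    - rewrite !Rminus_diag, Rabs_R0; lra.
    - replace (v (S (m + n)) - v n)
        with ((v (S (m + n)) - v (m + n)%nat) + (v (m + n)%nat - v n)) by ring.
      eapply Rle_trans; [apply Rabs_triang |].
      pose proof (Hv (m + n)%nat ltac:(lia)); lra. }
  assert (Hr0 : forall n, (N <= n)%nat -> 0 <= r n).
  { intros n Hn; refine (is_lim_seq_le _ (fun _ => r n) (Finite _) (Finite _) _
      (proj1 (is_lim_seq_incr_n r n _) Hr) (is_lim_seq_const (r n))).
    intros m; pose proof (Hsum n m Hn); pose proof (Rabs_pos (v (m + n)%nat - v n)); lra. }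
  assert (Hbound : forall n m, (N <= n)%nat -> Rabs (v (m + n)%nat - v n) <= r n).
  { intros n m Hn; pose proof (Hsum n m Hn); pose proof (Hr0 (m + n)%nat ltac:(lia)); lra. }
  assert (Hcv : ex_finite_lim_seq v).
  { apply ex_lim_seq_cauchy_corr; intros eps.
    apply is_lim_seq_spec in Hr; destruct (Hr (pos_div_2 eps)) as [N1 HN1].
    pose (M := (N + N1)%nat); specialize (HN1 M ltac:(unfold M; lia)); simpl in HN1.
    rewrite Rminus_0_r in HN1; apply Rabs_def2 in HN1.
    exists M; intros p q Hp Hq.
    assert (Bp := Hbound M (p - M)%nat ltac:(unfold M; lia)).
    assert (Bq := Hbound M (q - M)%nat ltac:(unfold M; lia)).
    replace (p - M + M)%nat with p in Bp by lia; replace (q - M + M)%nat with q in Bq by lia.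
    replace (v p - v q) with ((v p - v M) - (v q - v M)) by ring.
    eapply Rle_lt_trans; [apply Rabs_triang |]; rewrite Rabs_Ropp; lra. }
  destruct Hcv as [l Hl]; exists l; split; [exact Hl |]; intros n Hn.
  assert (L : is_lim_seq (fun m => Rabs (v (m + n)%nat - v n)) (Rabs (l - v n))).
  { apply (is_lim_seq_abs _ (Finite (l - v n))), is_lim_seq_minus'; [| apply is_lim_seq_const].
    apply (is_lim_seq_incr_n v n), Hl. }
  rewrite Rabs_minus_sym.
  exact (is_lim_seq_le _ _ _ (Finite _) (fun m => Hbound n m Hn) L (is_lim_seq_const (r n))).
Qed.

Lemma Cmod_minus_clim_le (u : nat -> C) (r : nat -> R) (N : nat) : is_lim_seq r 0 ->
  (forall n, (N <= n)%nat -> Cmod (u (S n) - u n)%C <= r n - r (S n)) ->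
  forall n, (N <= n)%nat -> Cmod (u n - clim u)%C <= 2 * r n.
Proof.
  intros Hr Hu n Hn.
  destruct (telescoping_cvg (fun n => Re (u n)) r N Hr) as (l1 & L1 & B1).
  { intros m Hm; eapply Rle_trans; [exact (re_le_Cmod (u (S m) - u m)%C) | apply Hu, Hm]. }
  destruct (telescoping_cvg (fun n => Im (u n)) r N Hr) as (l2 & L2 & B2).
  { intros m Hm; eapply Rle_trans; [exact (im_le_Cmod (u (S m) - u m)%C) | apply Hu, Hm]. }
  unfold clim; rewrite (is_lim_seq_unique _ _ L1), (is_lim_seq_unique _ _ L2).
  eapply Rle_trans; [apply Cmod_le_Rabs |].
  specialize (B1 n Hn); specialize (B2 n Hn); unfold Re, Im, Rminus in *; simpl in *; lra.
Qed.

Lemma clog_RtoC (x : R) : 0 < x -> clog (RtoC x) = RtoC (ln x).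
Proof.
  intros Hx; unfold clog; rewrite Cmod_R, Rabs_pos_eq, carg_Re_gt0 by (simpl; lra).
  apply injective_projections; simpl; [reflexivity |].
  unfold Rdiv; rewrite Rmult_0_l; apply atan_0.
Qed.

Lemma clog_mult_pos (r : R) (z : C) : 0 < r -> 0 < Re z ->
  clog (RtoC r * z)%C = (RtoC (ln r) + clog z)%C.
Proof.
  intros Hr Hz; assert (Hz0 := slit_plane_neq0 z (or_introl Hz)).
  assert (Hrz : 0 < Re (RtoC r * z)%C) by (destruct z; simpl in *; nra).
  unfold clog; rewrite Cmod_mult, Cmod_R, Rabs_pos_eq by lra.
  rewrite ln_mult by (try lra; apply Cmod_gt_0, Hz0).
  rewrite !carg_Re_gt0 by assumption.
  apply injective_projections; simpl; [reflexivity |].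
  rewrite Rplus_0_l; f_equal; destruct z; simpl in *; field; split; nra.
Qed.

Lemma Cmod_1_plus_ge (w : C) : Cmod w <= 1/2 -> 1/2 <= Cmod (1 + w)%C.
Proof.
  intros Hw; assert (T := Cmod_triangle (1 + w) (- w)).
  rewrite Cmod_opp in T; replace (1 + w + - w)%C with (RtoC 1) in T by ring.
  rewrite Cmod_1 in T; lra.
Qed.

Lemma Re_1_plus_gt0 (w : C) : Cmod w <= 1/2 -> 0 < Re (1 + w)%C.
Proof.
  intros Hw; assert (H := Rle_trans _ _ _ (re_le_Cmod w) Hw).
  apply Rabs_le_between in H; simpl; unfold Re in H; lra.
Qed.

Lemma Cmod_clog_1_plus_minus_le (w : C) : Cmod w <= 1/2 ->
  Cmod (clog (1 + w) - w)%C <= 2 * Cmod w ^ 2.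
Proof.
  intros Hw; pose (h := fun t : R => (clog (1 + RtoC t * w) - RtoC t * w)%C).
  replace (clog (1 + w) - w)%C with (h 1 - h 0)%C.
  2:{ unfold h; rewrite Cmult_1_l, Cmult_0_l, Cplus_0_r, clog_RtoC, ln_1 by lra; ring. }
  replace (2 * Cmod w ^ 2) with (2 * Cmod w ^ 2 * Rabs (1 - 0))
    by (rewrite Rminus_0_r, Rabs_R1; ring).
  apply (Cmod_mean_value_le h (fun t => / (1 + RtoC t * w) * w - w)%C).
  intros t Ht; rewrite Rmin_left, Rmax_right in Ht by lra.
  assert (Htw : Cmod (RtoC t * w)%C <= Cmod w).
  { rewrite Cmod_mult, Cmod_R, Rabs_pos_eq by lra; pose proof (Cmod_ge_0 w); nra. }
  assert (Hge := Cmod_1_plus_ge (RtoC t * w)%C ltac:(lra)).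
  split.
  - apply is_derive_RC_minus; [| apply is_derive_RC_ray].
    apply (is_derive_CC_path clog (fun t => 1 + RtoC t * w)%C); [| apply is_derive_RC_line].
    apply is_derive_clog; left; apply Re_1_plus_gt0; lra.
  - replace (/ (1 + t * w) * w - w)%C with (- (/ (1 + t * w) * (t * w) * w))%C
      by (field; apply Cmod_gt_0; lra).
    rewrite Cmod_opp, !Cmod_mult, Cmod_inv by (apply Cmod_gt_0; lra).
    rewrite Cmod_mult in Htw; pose proof (Cmod_ge_0 w).
    replace (2 * Cmod w ^ 2) with (2 * Cmod w * Cmod w) by ring.
    apply Rmult_le_compat_r; [assumption |].
    apply Rmult_le_compat; [| | | exact Htw].
    + left; apply Rinv_0_lt_compat; lra.
    + apply Rmult_le_pos; apply Cmod_ge_0.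
    + replace 2 with (/ (1/2)) by field; apply Rinv_le_contravar; lra.
Qed.

Definition logGamma_seq (n : nat) (z : C) : C :=
  (RtoC (ln (INR (fact n))) + z * RtoC (ln (INR n)) - sum_n (fun k => clog (z + RtoC (INR k))) n)%C.

Lemma logGamma_seq_S (n : nat) (z : C) : (1 <= n)%nat -> 2 * Cmod z <= INR (S n) ->
  let M := RtoC (INR (S n)) in
  (logGamma_seq (S n) z - logGamma_seq n z = - (z * clog (1 + - / M)) - clog (1 + z / M))%C.
Proof.
  intros Hn Hz; cbv zeta; unfold logGamma_seq; rewrite sum_Sn.
  assert (Hn0 : 1 <= INR n) by (apply (le_INR 1); exact Hn).
  assert (HM := S_INR n); set (M := INR (S n)) in *.
  rewrite fact_simpl, mult_INR, ln_mult by (apply lt_0_INR; try apply lt_O_fact; lia); fold M.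
  assert (HMC : RtoC M <> 0%C) by (apply RtoC_neq0; lra).
  assert (Hzn : clog (z + RtoC M)%C = (RtoC (ln M) + clog (1 + z / RtoC M))%C).
  { rewrite <- clog_mult_pos; [f_equal; field; exact HMC | lra |].
    apply Re_1_plus_gt0; rewrite Cmod_div, Cmod_R, Rabs_pos_eq by (assumption || lra).
    apply Rle_div_l; lra. }
  assert (Hln : RtoC (ln (INR n)) = (RtoC (ln M) + clog (1 + - / RtoC M))%C).
  { replace (1 + - / RtoC M)%C with (RtoC (INR n / M)).
    - rewrite clog_RtoC, <- RtoC_plus by (apply Rdiv_lt_0_compat; lra).
      f_equal; rewrite ln_div by lra; ring.
    - rewrite RtoC_div by lra; replace (INR n) with (M - 1) by lra.
      rewrite RtoC_minus; field; exact HMC. }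
  rewrite Hzn, Hln, RtoC_plus.
  change plus with Cplus; ring.
Qed.

Lemma Cmod_logGamma_seq_S_minus_le (n : nat) (z : C) : (1 <= n)%nat -> 2 * Cmod z <= INR (S n) ->
  Cmod (logGamma_seq (S n) z - logGamma_seq n z)%C
  <= 2 * (Cmod z + Cmod z ^ 2) * (/ INR n - / INR (S n)).
Proof.
  intros Hn Hz; rewrite logGamma_seq_S by assumption.
  assert (Hn0 : 1 <= INR n) by (apply (le_INR 1); exact Hn).
  assert (HM := S_INR n); set (M := INR (S n)) in *.
  assert (HMC : RtoC M <> 0%C) by (apply RtoC_neq0; lra).
  assert (Hc := Cmod_ge_0 z); set (c := Cmod z) in *.
  assert (Hw1 : Cmod (- / RtoC M)%C = / M).
  { rewrite Cmod_opp, Cmod_inv, Cmod_R, Rabs_pos_eq by (assumption || lra); reflexivity. }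
  assert (Hw2 : Cmod (z / RtoC M)%C = c / M).
  { rewrite Cmod_div, Cmod_R, Rabs_pos_eq by (assumption || lra); reflexivity. }
  assert (L1 : Cmod (clog (1 + - / RtoC M) - (- / RtoC M))%C <= 2 * (/ M) ^ 2).
  { rewrite <- Hw1; apply Cmod_clog_1_plus_minus_le; rewrite Hw1.
    replace (1/2) with (/ 2) by field; apply Rinv_le_contravar; lra. }
  assert (L2 : Cmod (clog (1 + z / RtoC M) - z / RtoC M)%C <= 2 * (c / M) ^ 2).
  { rewrite <- Hw2; apply Cmod_clog_1_plus_minus_le; rewrite Hw2; apply Rle_div_l; lra. }
  set (u := clog (1 + - / RtoC M)%C) in *; set (v := clog (1 + z / RtoC M)%C) in *.
  replace (- (z * u) - v)%C with (- (z * (u - - / RtoC M)) + - (v - z / RtoC M))%C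
    by (field; exact HMC).
  eapply Rle_trans; [apply Cmod_triangle |]; rewrite !Cmod_opp, Cmod_mult; fold c.
  apply Rle_trans with (2 * (c + c ^ 2) * (/ M) ^ 2).
  - unfold Rdiv in L2; nra.
  - apply Rmult_le_compat_l; [nra |].
    replace (/ INR n - / M) with (/ (INR n * M)) by (rewrite HM; field; lra).
    rewrite pow_inv; apply Rinv_le_contravar; nra.
Qed.

Lemma is_lim_seq_div_INR (c : R) : is_lim_seq (fun n => c * / INR n) 0.
Proof.
  replace (Finite 0) with (Rbar_mult c 0) by (simpl; f_equal; ring).
  apply is_lim_seq_scal_l, (is_lim_seq_inv INR p_infty); [apply is_lim_seq_INR | discriminate].
Qed.

Lemma Cmod_logGamma_seq_minus_le (n : nat) (z : C) : (1 <= n)%nat -> 2 * Cmod z <= INR (S n) ->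
  Cmod (logGamma_seq n z - logGamma z)%C <= 4 * (Cmod z + Cmod z ^ 2) / INR n.
Proof.
  intros Hn Hz; pose (c := 2 * (Cmod z + Cmod z ^ 2)).
  replace (4 * (Cmod z + Cmod z ^ 2) / INR n) with (2 * (c * / INR n))
    by (unfold c; field; apply not_0_INR; lia).
  apply (Cmod_minus_clim_le (fun n => logGamma_seq n z) (fun n => c * / INR n) n);
    [apply is_lim_seq_div_INR | | apply le_n].
  intros m Hm; rewrite <- Rmult_minus_distr_l; apply Cmod_logGamma_seq_S_minus_le; [lia |].
  apply Rle_trans with (1 := Hz), le_INR; lia.
Qed.

Lemma logGamma_seq_cvg_unif (M : R) : cvg_unif (fun z => Cmod z <= M) logGamma_seq logGamma.
Proof.
  destruct (Rlt_dec M 0) as [HM | HM].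
  { intros eps _; apply filter_forall; intros n z Hz; pose proof (Cmod_ge_0 z); lra. }
  apply (cvg_unif_rate _ _ _ (fun n => 4 * (M + M ^ 2) * / INR n)); [apply is_lim_seq_div_INR |].
  destruct (INR_unbounded (2 * M)) as [N HN]; exists (S N); intros n Hn z Hz.
  apply le_INR in Hn as Hn'; rewrite S_INR in Hn'.
  eapply Rle_trans; [apply Cmod_logGamma_seq_minus_le; [lia | rewrite S_INR; lra] |].
  pose proof (Cmod_ge_0 z); unfold Rdiv; apply Rmult_le_compat_r; [| nra].
  left; apply Rinv_0_lt_compat, lt_0_INR; lia.
Qed.

Lemma holomorphic_on_logGamma_seq (D : C -> Prop) (n : nat) (f : C -> C) :
  (forall z k, D z -> slit_plane (f z + RtoC (INR k))%C) ->
  holomorphic_on D f -> holomorphic_on D (fun z => logGamma_seq n (f z)).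
Proof.
  intros Hs Hf; apply holomorphic_on_minus.
  - apply holomorphic_on_plus; [apply holomorphic_on_const |].
    apply holomorphic_on_mult; [exact Hf | apply holomorphic_on_const].
  - apply (holomorphic_on_sum_n D (fun k z => clog (f z + RtoC (INR k))%C)); intros k.
    apply holomorphic_on_clog; [intros z Hz; apply Hs, Hz |].
    apply holomorphic_on_plus; [exact Hf | apply holomorphic_on_const].
Qed.

(** * Growth of the factors of the integrand *)

Lemma ln_le_sub1 (x : R) : 0 < x -> ln x <= x - 1.
Proof. intros Hx; pose proof (exp_ineq1_le (ln x)) as H; rewrite exp_ln in H by exact Hx; lra. Qed.

Lemma ln_ge_1_sub_inv (x : R) : 0 < x -> 1 - / x <= ln x.
Proof.
  intros Hx; pose proof (ln_le_sub1 (/ x) (Rinv_0_lt_compat _ Hx)) as H.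
  rewrite ln_Rinv in H by exact Hx; lra.
Qed.

Lemma ln_sqrt_half (x : R) : 0 < x -> ln (sqrt x) = / 2 * ln x.
Proof.
  intros Hx; rewrite <- (sqrt_sqrt x) at 2 by lra.
  rewrite ln_mult by (apply sqrt_lt_R0; lra); lra.
Qed.

Lemma ln_Cmod_ratio_ge (m h y : R) : 0 < m -> 0 < h < 1 -> 0 < (m - h) ^ 2 + y ^ 2 ->
  2 * h * (m / ((m + 1) ^ 2 + y ^ 2)) <= ln (Cmod (m + h, y)) - ln (Cmod (m - h, - y)).
Proof.
  intros Hm Hh HP; unfold Cmod; simpl fst; simpl snd.
  replace ((- y) ^ 2) with (y ^ 2) by ring.
  set (P := (m - h) ^ 2 + y ^ 2) in *; set (Q := (m + h) ^ 2 + y ^ 2).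
  assert (HQ : Q = P + 4 * m * h) by (unfold P, Q; ring).
  assert (HQ0 : 0 < Q) by nra.
  rewrite !ln_sqrt_half, <- Rmult_minus_distr_l, <- ln_div by assumption.
  assert (Hr : 0 < Q / P) by (apply Rdiv_lt_0_compat; assumption).
  pose proof (ln_ge_1_sub_inv _ Hr) as L.
  replace (1 - / (Q / P)) with (4 * m * h / Q) in L by (rewrite HQ in *; field; lra).
  apply Rle_trans with (2 * h * (m / Q)); [| unfold Rdiv in *; lra].
  apply Rmult_le_compat_l; [lra |]; unfold Rdiv; apply Rmult_le_compat_l; [lra |].
  apply Rinv_le_contravar; [exact HQ0 | unfold Q; nra].
Qed.

(* The logarithm is an antiderivative of [x / ((x + 1) ^ 2 + y ^ 2)] up to an error
   [O(1 / x ^ 2)], which the second term absorbs. *)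
Definition log_potential (y x : R) : R := / 2 * ln ((x + 1) ^ 2 + y ^ 2) + 3/2 * / (x + 1/2).

Lemma log_potential_step (y x : R) : 0 <= x ->
  log_potential y (x + 1) - log_potential y x <= x / ((x + 1) ^ 2 + y ^ 2).
Proof.
  intros Hx; unfold log_potential; set (P := (x + 1) ^ 2 + y ^ 2).
  assert (HP : (x + 1) ^ 2 <= P) by (unfold P; nra).
  assert (HP0 : 0 < P) by nra.
  replace ((x + 1 + 1) ^ 2 + y ^ 2) with (P + (2 * x + 3)) by (unfold P; ring).
  assert (Hln : ln (P + (2 * x + 3)) - ln P <= (2 * x + 3) / P).
  { rewrite <- ln_div by lra.
    eapply Rle_trans; [apply ln_le_sub1, Rdiv_lt_0_compat; lra |].
    right; field; lra. }
  assert (Hinv : / P <= / (x + 1/2) - / (x + 1 + 1/2)).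
  { replace (/ (x + 1/2) - / (x + 1 + 1/2)) with (/ ((x + 1/2) * (x + 1 + 1/2))) by (field; lra).
    apply Rinv_le_contravar; nra. }
  replace (x / P) with (/ 2 * ((2 * x + 3) / P) - 3/2 * / P) by (field; lra).
  lra.
Qed.

Lemma log_potential_ge0 (y x : R) : 0 <= x -> 0 <= log_potential y x.
Proof.
  intros Hx; unfold log_potential.
  assert (0 <= ln ((x + 1) ^ 2 + y ^ 2)) by (rewrite <- ln_1; apply ln_le; nra).
  assert (0 < / (x + 1/2)) by (apply Rinv_0_lt_compat; lra); lra.
Qed.

Lemma ln_le_log_potential (y x : R) : 0 < x -> ln x <= log_potential y x.
Proof.
  intros Hx; unfold log_potential.
  assert (0 < / (x + 1/2)) by (apply Rinv_0_lt_compat; lra).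
  assert (Hln : ln (x * x) <= ln ((x + 1) ^ 2 + y ^ 2)) by (apply ln_le; nra).
  rewrite ln_mult in Hln by lra; lra.
Qed.

Lemma sum_n_ln_Cmod_ratio_ge (c h y : R) (n : nat) : 0 < c -> 0 < h < 1 -> y <> 0 \/ h < c ->
  2 * h * (log_potential y (c + INR (S n)) - log_potential y c) <=
  sum_n (fun k => ln (Cmod (c + INR k + h, y))) n
  - sum_n (fun k => ln (Cmod (c + INR k - h, - y))) n.
Proof.
  intros Hc Hh Hy.
  assert (Hk : forall k, 2 * h * (log_potential y (c + INR (S k)) - log_potential y (c + INR k)) <=
    ln (Cmod (c + INR k + h, y)) - ln (Cmod (c + INR k - h, - y))).
  { intros k; pose proof (pos_INR k); rewrite S_INR, <- Rplus_assoc.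
    eapply Rle_trans; [| apply ln_Cmod_ratio_ge; try lra].
    - apply Rmult_le_compat_l; [lra |]; apply log_potential_step; lra.
    - pose proof (pow2_ge_0 y); pose proof (pow2_ge_0 (c + INR k - h)); destruct Hy as [Hy | Hy].
      + pose proof (pow2_gt_0 y Hy); lra.
      + pose proof (pow2_gt_0 (c + INR k - h) ltac:(lra)); lra. }
  induction n as [|n IH].
  - rewrite !sum_O; pose proof (Hk 0%nat) as H0; rewrite INR_0, (Rplus_0_r c) in *; exact H0.
  - rewrite !sum_Sn; change plus with Rplus; pose proof (Hk (S n)); lra.
Qed.

Lemma Re_logGamma_seq (n : nat) (z : C) : Re (logGamma_seq n z) =
  ln (INR (fact n)) + Re z * ln (INR n) - sum_n (fun k => ln (Cmod (z + RtoC (INR k))%C)) n.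
Proof.
  assert (E : Re (sum_n (fun k => clog (z + RtoC (INR k))%C) n) =
              sum_n (fun k => ln (Cmod (z + RtoC (INR k))%C)) n).
  { induction n as [|n IH]; [rewrite !sum_O; reflexivity |].
    rewrite !sum_Sn, <- IH; reflexivity. }
  rewrite <- E; unfold logGamma_seq, Re; simpl; ring.
Qed.

Lemma Re_logGamma_seq_minus_le (n : nat) (c h y : R) : (1 <= n)%nat ->
  0 < c -> 0 < h < 1 -> y <> 0 \/ h < c ->
  Re (logGamma_seq n (c + h, y)) - Re (logGamma_seq n (c - h, - y)) <= 2 * log_potential y c.
Proof.
  intros Hn Hc Hh Hy; rewrite !Re_logGamma_seq.
  assert (Hsum := sum_n_ln_Cmod_ratio_ge c h y n Hc Hh Hy).
  rewrite (sum_n_ext (fun k => ln (Cmod (((c + h)%R, y) + RtoC (INR k))%C))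
    (fun k => ln (Cmod (c + INR k + h, y))))
    by (intros k; do 2 f_equal; apply injective_projections; simpl; ring).
  rewrite (sum_n_ext (fun k => ln (Cmod (((c - h)%R, (- y)%R) + RtoC (INR k))%C))
    (fun k => ln (Cmod (c + INR k - h, - y))))
    by (intros k; do 2 f_equal; apply injective_projections; simpl; ring).
  assert (Hn1 : 1 <= INR n) by (apply (le_INR 1); exact Hn).
  assert (P := log_potential_ge0 y c ltac:(lra)).
  assert (L := ln_le_log_potential y (c + INR (S n)) ltac:(rewrite S_INR; lra)).
  assert (Lm : ln (INR n) <= ln (c + INR (S n))) by (apply ln_le; rewrite ?S_INR; lra).
  simpl Re; nra.
Qed.

Definition RStheta_seq (n : nat) (w : C) : C :=
  ((logGamma_seq n (RtoC (1/4) + Ci * w / RtoC 2) - logGamma_seq n (RtoC (1/4) - Ci * w / RtoC 2))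
     / (RtoC 2 * Ci) - w / RtoC 2 * RtoC (ln PI))%C.

Lemma RStheta_arg_plus (w : C) : (RtoC (1/4) + Ci * w / RtoC 2)%C = (1/4 - Im w / 2, Re w / 2).
Proof. apply injective_projections; unfold Re, Im; simpl; field. Qed.

Lemma RStheta_arg_minus (w : C) : (RtoC (1/4) - Ci * w / RtoC 2)%C = (1/4 + Im w / 2, - (Re w / 2)).
Proof. apply injective_projections; unfold Re, Im; simpl; field. Qed.

Lemma holomorphic_on_RStheta_seq (D : C -> Prop) (n : nat) (f : C -> C) :
  (forall z, D z -> Rabs (Im (f z)) < 1/2 \/ Re (f z) <> 0) ->
  holomorphic_on D f -> holomorphic_on D (fun z => RStheta_seq n (f z)).
Proof.
  intros HD Hf; unfold RStheta_seq.
  assert (Harg : holomorphic_on D (fun z => Ci * f z / RtoC 2)%C).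
  { apply holomorphic_on_mult; [| apply holomorphic_on_const].
    apply holomorphic_on_mult; [apply holomorphic_on_const | exact Hf]. }
  apply holomorphic_on_minus.
  - apply holomorphic_on_mult; [| apply holomorphic_on_const].
    apply holomorphic_on_minus; apply holomorphic_on_logGamma_seq.
    + intros z k Hz; rewrite RStheta_arg_plus; pose proof (pos_INR k).
      destruct (HD z Hz) as [H1 | H1]; [left | right]; simpl; [apply Rabs_lt_between in H1 |]; lra.
    + apply holomorphic_on_plus; [apply holomorphic_on_const | exact Harg].
    + intros z k Hz; rewrite RStheta_arg_minus; pose proof (pos_INR k).
      destruct (HD z Hz) as [H1 | H1]; [left | right]; simpl; [apply Rabs_lt_between in H1 |]; lra.
    + apply holomorphic_on_minus; [apply holomorphic_on_const | exact Harg].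
  - apply holomorphic_on_mult; [| apply holomorphic_on_const].
    apply holomorphic_on_mult; [exact Hf | apply holomorphic_on_const].
Qed.

Lemma Re_Ci_RStheta_formula (A B w : C) (L : R) :
  Re (Ci * ((A - B) / (RtoC 2 * Ci) - w / RtoC 2 * RtoC L))%C = (Re A - Re B) / 2 + Im w / 2 * L.
Proof.
  replace (Ci * ((A - B) / (RtoC 2 * Ci) - w / RtoC 2 * RtoC L))%C
    with ((A - B) / RtoC 2 - Ci * w / RtoC 2 * RtoC L)%C
    by (field; repeat split; (apply Ci_nz || (apply RtoC_neq0; lra))).
  unfold Re, Im; simpl; field.
Qed.

Lemma exp_Re_Ci_RStheta_seq_le (n : nat) (w : C) : (1 <= n)%nat -> -2 < Im w < 0 ->
  Re w <> 0 \/ - (1/2) < Im w -> exp (Re (Ci * RStheta_seq n w)%C) <= exp 2 * (2 + Rabs (Re w)).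
Proof.
  intros Hn Hw Hw0; unfold RStheta_seq.
  rewrite Re_Ci_RStheta_formula, RStheta_arg_plus, RStheta_arg_minus.
  pose (h := - Im w / 2); pose (y := Re w / 2).
  assert (P := Re_logGamma_seq_minus_le n (1/4) h y Hn ltac:(lra) ltac:(unfold h; lra)
    ltac:(unfold h, y; destruct Hw0; [left | right]; lra)).
  replace (1/4 - Im w / 2) with (1/4 + h) by (unfold h; field).
  replace (1/4 + Im w / 2) with (1/4 - h) by (unfold h; field).
  fold y; replace (Im w / 2) with (- h) by (unfold h; field).
  assert (Hpi : 0 <= h * ln PI).
  { apply Rmult_le_pos; [unfold h; lra |].
    rewrite <- ln_1; apply ln_le; [lra | pose proof PI2_3_2; lra]. }
  apply Rle_trans with (exp (log_potential y (1/4))); [apply exp_le; lra |].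
  assert (Hq : 0 < (1/4 + 1) ^ 2 + y ^ 2) by nra.
  unfold log_potential; replace (3/2 * / (1/4 + 1/2)) with 2 by field.
  rewrite Rplus_comm, exp_plus, <- ln_sqrt_half, exp_ln by (try apply sqrt_lt_R0; exact Hq).
  apply Rmult_le_compat_l; [left; apply exp_pos |].
  pose proof (Rabs_pos (Re w)); pose proof (pow2_abs (Re w)).
  apply Rsqr_incr_0_var; [| lra].
  rewrite Rsqr_sqrt by lra; unfold Rsqr, y; nra.
Qed.

Lemma Re_Ci_RStheta (t : R) : Re (Ci * RStheta (RtoC t))%C = 0.
Proof.
  unfold RStheta; rewrite Re_Ci_RStheta_formula.
  assert (E : Re (logGamma (RtoC (1/4) + Ci * RtoC t / RtoC 2)%C)
            = Re (logGamma (RtoC (1/4) - Ci * RtoC t / RtoC 2)%C)).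
  { change (real (Lim_seq (fun n => Re (logGamma_seq n (RtoC (1/4) + Ci * RtoC t / RtoC 2)%C))) =
            real (Lim_seq (fun n => Re (logGamma_seq n (RtoC (1/4) - Ci * RtoC t / RtoC 2)%C)))).
    f_equal; apply Lim_seq_ext; intros n.
    rewrite !Re_logGamma_seq, RStheta_arg_plus, RStheta_arg_minus; f_equal; [simpl; field |].
    apply sum_n_ext; intros k; f_equal; unfold Cmod; f_equal; simpl; field. }
  rewrite E; simpl; field.
Qed.

Lemma Cmod_RStheta_arg_le (w : C) (M : R) : Cmod w <= M ->
  Cmod (RtoC (1/4) + Ci * w / RtoC 2)%C <= 1 + M /\ Cmod (RtoC (1/4) - Ci * w / RtoC 2)%C <= 1 + M.
Proof.
  intros Hw; pose proof (Cmod_ge_0 w).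
  assert (E : Cmod (Ci * w / RtoC 2)%C = Cmod w / 2).
  { rewrite Cmod_div, Cmod_mult, Cmod_Ci, Cmod_R, Rabs_pos_eq
      by ((apply RtoC_neq0; lra) || lra); lra. }
  split; (eapply Rle_trans; [apply Cmod_triangle |]);
    rewrite ?Cmod_opp, E, Cmod_R, Rabs_pos_eq by lra; lra.
Qed.

Lemma RStheta_seq_cvg_unif (M : R) : cvg_unif (fun w => Cmod w <= M) RStheta_seq RStheta.
Proof.
  apply (cvg_unif_lipschitz _
    (fun n w => logGamma_seq n (RtoC (1/4) + Ci * w / RtoC 2)
                - logGamma_seq n (RtoC (1/4) - Ci * w / RtoC 2))%C
    (fun w => logGamma (RtoC (1/4) + Ci * w / RtoC 2)
              - logGamma (RtoC (1/4) - Ci * w / RtoC 2))%C _ _ (/ 2)); [lra | |].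
  - intros n w _; right; unfold RStheta_seq, RStheta.
    set (A := logGamma_seq n _); set (B := logGamma_seq n _).
    set (A' := logGamma _); set (B' := logGamma _).
    replace (_ - _)%C with ((A - B - (A' - B')) / (RtoC 2 * Ci))%C
      by (field; repeat split; (apply Ci_nz || (apply RtoC_neq0; lra))).
    rewrite Cmod_div, Cmod_mult, Cmod_Ci, Cmod_R, Rabs_pos_eq by
      (apply Cmult_neq_0; [apply RtoC_neq0; lra | apply Ci_nz]) || lra.
    unfold Rdiv; rewrite Rmult_1_r; apply Rmult_comm.
  - apply cvg_unif_minus; apply (cvg_unif_comp _ (fun z => Cmod z <= 1 + M) logGamma_seq logGamma);
      try apply logGamma_seq_cvg_unif; intros w Hw; apply Cmod_RStheta_arg_le, Hw.
Qed.

Lemma Cmod_cexp_sub1_le (z : C) : Cmod z <= 1 -> Cmod (cexp z - 1)%C <= exp 1 * Cmod z.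
Proof.
  intros Hz; pose (h := fun t : R => cexp (RtoC t * z)).
  assert (E0 : cexp 0%C = 1%C)
    by (apply injective_projections; simpl; rewrite exp_0, ?cos_0, ?sin_0; ring).
  replace (cexp z - 1)%C with (h 1 - h 0)%C
    by (unfold h; rewrite Cmult_1_l, Cmult_0_l, E0; reflexivity).
  replace (exp 1 * Cmod z) with (exp 1 * Cmod z * Rabs (1 - 0))
    by (rewrite Rminus_0_r, Rabs_R1; ring).
  apply (Cmod_mean_value_le h (fun t => cexp (RtoC t * z) * z)%C).
  intros t Ht; rewrite Rmin_left, Rmax_right in Ht by lra; split.
  - apply (is_derive_CC_path cexp (fun t => RtoC t * z)%C); [apply is_derive_cexp |].
    apply is_derive_RC_ray.
  - rewrite Cmod_mult, Cmod_cexp; apply Rmult_le_compat_r; [apply Cmod_ge_0 |]; apply exp_le.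
    pose proof (re_le_Cmod (RtoC t * z)%C) as Hre.
    rewrite Cmod_mult, Cmod_R, (Rabs_pos_eq t) in Hre by lra.
    eapply Rle_trans; [apply Rle_abs |]; eapply Rle_trans; [exact Hre |].
    pose proof (Cmod_ge_0 z); nra.
Qed.

Lemma cvg_unif_cexp {T : Type} (P : T -> Prop) (fn : nat -> T -> C) (f : T -> C) :
  unif_bounded P (fun n x => cexp (fn n x)) -> cvg_unif P fn f ->
  cvg_unif P (fun n x => cexp (fn n x)) (fun x => cexp (f x)).
Proof.
  intros HM Hf eps Heps; apply unif_bounded_gt0 in HM as (M & HM0 & HM).
  assert (He := exp_pos 1).
  assert (HK : 0 < M * exp 1) by (apply Rmult_lt_0_compat; assumption).
  assert (Hd : 0 < Rmin 1 (eps / (M * exp 1)))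
    by (apply Rmin_glb_lt; [lra | apply Rdiv_lt_0_compat; assumption]).
  generalize (Hf _ Hd); apply filter_imp; intros n Hn x Hx; specialize (Hn x Hx).
  assert (H1 := Rlt_le_trans _ _ _ Hn (Rmin_l _ _)).
  assert (H2 := Rlt_le_trans _ _ _ Hn (Rmin_r _ _)); apply Rlt_div_r in H2; [| exact HK].
  rewrite <- Cmod_opp in H1, H2; set (d := (- (fn n x - f x))%C) in *.
  replace (cexp (f x)) with (cexp (fn n x) * cexp d)%C
    by (rewrite <- cexp_plus; f_equal; unfold d; ring).
  replace (cexp (fn n x) - cexp (fn n x) * cexp d)%C
    with (- (cexp (fn n x) * (cexp d - 1)))%C by ring.
  rewrite Cmod_opp, Cmod_mult; apply Rle_lt_trans with (2 := H2).
  rewrite (Rmult_comm (Cmod d)), Rmult_assoc.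
  apply Rmult_le_compat; auto using Cmod_ge_0; apply Cmod_cexp_sub1_le; lra.
Qed.

Lemma csinh_eq (z : C) : csinh z = (sinh (Re z) * cos (Im z), cosh (Re z) * sin (Im z)).
Proof.
  destruct z as [x y]; unfold csinh, cexp, sinh, cosh.
  apply injective_projections; simpl; rewrite ?cos_neg, ?sin_neg; field.
Qed.

Lemma Cmod_csinh_sqr (z : C) : Cmod (csinh z) ^ 2 = sinh (Re z) ^ 2 + sin (Im z) ^ 2.
Proof.
  rewrite Cmod2_alt, csinh_eq; cbn [Re Im fst snd].
  assert (Hsc := sin2_cos2 (Im z)); unfold Rsqr in Hsc.
  assert (Hch : cosh (Re z) ^ 2 = sinh (Re z) ^ 2 + 1).
  { assert (E : exp (Re z) * exp (- Re z) = 1) by (rewrite <- exp_plus, Rplus_opp_r; apply exp_0).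
    unfold cosh, sinh; nra. }
  rewrite !Rpow_mult_distr, Hch.
  replace (cos (Im z) ^ 2) with (1 - sin (Im z) ^ 2) by (simpl; lra); ring.
Qed.

Lemma Rabs_sinh_le_Cmod_csinh (z : C) : Rabs (sinh (Re z)) <= Cmod (csinh z).
Proof.
  apply Rsqr_incr_0; auto using Rabs_pos, Cmod_ge_0.
  rewrite <- Rsqr_abs, !Rsqr_pow2, Cmod_csinh_sqr; pose proof (pow2_ge_0 (sin (Im z))); lra.
Qed.

Lemma Rabs_sin_le_Cmod_csinh (z : C) : Rabs (sin (Im z)) <= Cmod (csinh z).
Proof.
  apply Rsqr_incr_0; auto using Rabs_pos, Cmod_ge_0.
  rewrite <- Rsqr_abs, !Rsqr_pow2, Cmod_csinh_sqr; pose proof (pow2_ge_0 (sinh (Re z))); lra.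
Qed.

Lemma sinh_opp (x : R) : sinh (- x) = - sinh x.
Proof. unfold sinh; rewrite Ropp_involutive; field. Qed.

Lemma exp_Rabs_le_sinh (u : R) : 1 <= Rabs u -> exp (Rabs u) / 4 <= Rabs (sinh (PI * u / 2)).
Proof.
  assert (Hpos : forall v, 1 <= v -> exp v / 4 <= sinh (PI * v / 2)).
  { intros v Hv; unfold sinh; assert (HP := PI2_3_2).
    assert (H1 : exp (v + v / 2) <= exp (PI * v / 2)) by (apply exp_le; nra).
    assert (H2 : exp (- (PI * v / 2)) <= 1) by (rewrite <- exp_0; apply exp_le; nra).
    rewrite exp_plus in H1; pose proof (exp_ineq1_le (v / 2)); pose proof (exp_ineq1_le v); nra. }
  unfold Rabs at 1 2; intros Hu; destruct (Rcase_abs u).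
  - eapply Rle_trans; [apply (Hpos _ Hu) |].
    replace (PI * - u / 2) with (- (PI * u / 2)) by field.
    rewrite sinh_opp, <- Rabs_Ropp; apply Rle_abs.
  - eapply Rle_trans; [apply (Hpos _ Hu) | apply Rle_abs].
Qed.

Definition Ukernel (x : C) : C := (RtoC PI / (RtoC 2 * csinh (RtoC PI * x / RtoC 2)))%C.

Lemma Re_Im_PI_div_2 (x : C) :
  Re (RtoC PI * x / RtoC 2)%C = PI * Re x / 2 /\ Im (RtoC PI * x / RtoC 2)%C = PI * Im x / 2.
Proof. split; unfold Re, Im; simpl; field. Qed.

Lemma sin_PI_div_2_neq0 (y : R) : -2 < y < 0 -> sin (PI * y / 2) <> 0.
Proof. intros Hy; pose proof PI_RGT_0; apply Rlt_not_eq, sin_lt_0_var; nra. Qed.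

Lemma csinh_neq0 (x : C) : -2 < Im x < 0 -> csinh (RtoC PI * x / RtoC 2)%C <> 0%C.
Proof.
  intros Hx; apply Cmod_gt_0.
  eapply Rlt_le_trans; [| apply Rabs_sin_le_Cmod_csinh].
  rewrite (proj2 (Re_Im_PI_div_2 x)); apply Rabs_pos_lt, sin_PI_div_2_neq0, Hx.
Qed.

Lemma Cmod_Ukernel_le (x : C) (m : R) : 0 < m -> m <= Cmod (csinh (RtoC PI * x / RtoC 2)%C) ->
  Cmod (Ukernel x) <= 2 / m.
Proof.
  intros Hm Hle; unfold Ukernel; set (z := csinh _) in *.
  assert (Hz : z <> 0%C) by (apply Cmod_gt_0; lra).
  rewrite Cmod_div, Cmod_mult, !Cmod_R by (apply Cmult_neq_0; [apply RtoC_neq0; lra | exact Hz]).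
  pose proof PI_4; pose proof PI_RGT_0; rewrite !Rabs_pos_eq by lra.
  replace (PI / (2 * Cmod z)) with (PI / 2 * / Cmod z) by (field; lra).
  unfold Rdiv at 2; apply Rmult_le_compat; [lra | left; apply Rinv_0_lt_compat; lra | lra |].
  apply Rinv_le_contravar; assumption.
Qed.

Lemma Cmod_Ukernel_le_exp (x : C) : 1 <= Rabs (Re x) -> Cmod (Ukernel x) <= 8 * exp (- Rabs (Re x)).
Proof.
  intros Hx; assert (He := exp_pos (Rabs (Re x))).
  replace (8 * exp (- Rabs (Re x))) with (2 / (exp (Rabs (Re x)) / 4))
    by (rewrite exp_Ropp; field; lra).
  apply Cmod_Ukernel_le; [lra |].
  eapply Rle_trans; [apply exp_Rabs_le_sinh, Hx |].
  rewrite <- (proj1 (Re_Im_PI_div_2 x)); apply Rabs_sinh_le_Cmod_csinh.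
Qed.

Lemma unif_bounded_Ukernel (P : C -> Prop) (y : R) : -2 < y < 0 -> (forall x, P x -> Im x = y) ->
  unif_bounded P (fun _ => Ukernel).
Proof.
  intros Hy HP; exists (2 / Rabs (sin (PI * y / 2))); intros _ x Hx; apply Cmod_Ukernel_le.
  - apply Rabs_pos_lt, sin_PI_div_2_neq0, Hy.
  - rewrite <- (HP x Hx), <- (proj2 (Re_Im_PI_div_2 x)); apply Rabs_sin_le_Cmod_csinh.
Qed.

Lemma holomorphic_on_Ukernel (D : C -> Prop) :
  (forall x, D x -> -2 < Im x < 0) -> holomorphic_on D Ukernel.
Proof.
  intros HD; apply holomorphic_on_div.
  - intros x Hx; apply Cmult_neq_0; [apply RtoC_neq0; lra | apply csinh_neq0, HD, Hx].
  - apply holomorphic_on_const.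
  - assert (Harg : holomorphic_on D (fun x => RtoC PI * x / RtoC 2)%C).
    { apply holomorphic_on_mult; [| apply holomorphic_on_const].
      apply holomorphic_on_mult; [apply holomorphic_on_const | apply holomorphic_on_id]. }
    apply holomorphic_on_mult; [apply holomorphic_on_const |].
    apply holomorphic_on_mult; [| apply holomorphic_on_const].
    apply holomorphic_on_minus; apply holomorphic_on_cexp; [| apply holomorphic_on_opp]; exact Harg.
Qed.

(** * The truncated integrand *)

Definition Uintegrand_seq (n : nat) (t : R) (x : C) : C :=
  (cexp (Ci * RStheta_seq (S n) (RtoC t + x) - Ci * RStheta (RtoC t))
   * zeta_trunc n (RtoC (1/2) + Ci * (RtoC t + x)) * Ukernel x)%C.

(* Here the arguments of the logarithms stay off the cut, and [1/2 + i (t + x)] stays at a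
   distance at least [1/8] from the pole of zeta. *)
Definition Udomain (t : R) (x : C) : Prop :=
  -2 < Im x < 0 /\ (1/2 < t + Re x \/ -3/8 < Im x).

Lemma zeta_arg_eq (t : R) (x : C) :
  (RtoC (1/2) + Ci * (RtoC t + x))%C = (1/2 - Im x, t + Re x).
Proof. apply injective_projections; unfold Re, Im; simpl; ring. Qed.

Lemma Re_zeta_arg_ge (t : R) (x : C) :
  Im x < 0 -> 1/2 <= Re (RtoC (1/2) + Ci * (RtoC t + x))%C.
Proof. intros Hx; rewrite zeta_arg_eq; simpl; lra. Qed.

Lemma Udomain_pole_dist (t : R) (x : C) : Udomain t x ->
  1/8 <= Cmod (RtoC (1/2) + Ci * (RtoC t + x) - 1)%C.
Proof.
  rewrite zeta_arg_eq; intros [Hx [H | H]].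
  - eapply Rle_trans; [| apply im_le_Cmod]; simpl; rewrite Rabs_pos_eq; lra.
  - eapply Rle_trans; [| apply re_le_Cmod]; simpl; rewrite Rabs_left; lra.
Qed.

Lemma Udomain_zeta_arg_neq1 (t : R) (x : C) : Udomain t x ->
  (RtoC (1/2) + Ci * (RtoC t + x))%C <> 1%C.
Proof.
  intros Hx E; apply Udomain_pole_dist in Hx; rewrite E in Hx.
  unfold Cminus in Hx; rewrite Cplus_opp_r, Cmod_0 in Hx; lra.
Qed.

Lemma holomorphic_on_Uintegrand_seq (n : nat) (t : R) :
  holomorphic_on (Udomain t) (Uintegrand_seq n t).
Proof.
  assert (Hw : holomorphic_on (Udomain t) (fun x => RtoC t + x)%C)
    by (apply holomorphic_on_plus; [apply holomorphic_on_const | apply holomorphic_on_id]).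
  assert (Hiw : holomorphic_on (Udomain t) (fun x => Ci * (RtoC t + x))%C)
    by (apply holomorphic_on_mult; [apply holomorphic_on_const | exact Hw]).
  apply holomorphic_on_mult; [apply holomorphic_on_mult |].
  - apply holomorphic_on_cexp, holomorphic_on_minus; [| apply holomorphic_on_const].
    apply holomorphic_on_mult; [apply holomorphic_on_const |].
    apply holomorphic_on_RStheta_seq; [| exact Hw].
    intros x [Hx1 Hx2]; simpl; unfold Re, Im in *; destruct Hx2; [right; lra | left].
    apply Rabs_lt_between; lra.
  - apply holomorphic_on_zeta_trunc.
    + intros x [Hx _]; apply slit_plane_neq0; left; pose proof (Re_zeta_arg_ge t x); lra.
    + intros x Hx; apply Udomain_zeta_arg_neq1, Hx.
    + apply holomorphic_on_plus; [apply holomorphic_on_const | exact Hiw].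
  - apply holomorphic_on_Ukernel; intros x [Hx _]; exact Hx.
Qed.

Lemma Cmod_cexp_RStheta_seq_le (n : nat) (t : R) (x : C) : Udomain t x ->
  Cmod (cexp (Ci * RStheta_seq (S n) (RtoC t + x) - Ci * RStheta (RtoC t))%C)
  <= exp 2 * (2 + Rabs (t + Re x)).
Proof.
  intros [Hx1 Hx2]; rewrite Cmod_cexp.
  change (Re (?a - ?b)%C) with (Re a - Re b); rewrite Re_Ci_RStheta, Rminus_0_r.
  apply exp_Re_Ci_RStheta_seq_le; [lia | |]; simpl; unfold Re, Im in *; lra.
Qed.

Lemma Cmod_zeta_arg_le (t : R) (x : C) : -2 < Im x < 0 ->
  Cmod (RtoC (1/2) + Ci * (RtoC t + x))%C <= 3 + Rabs (t + Re x).
Proof.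
  intros Hx; rewrite zeta_arg_eq; eapply Rle_trans; [apply Cmod_le_Rabs |]; simpl.
  rewrite (Rabs_pos_eq (1/2 - Im x)) by lra; lra.
Qed.

Lemma Cmod_zeta_trunc_arg_le (n : nat) (t : R) (x : C) : Udomain t x ->
  Cmod (zeta_trunc n (RtoC (1/2) + Ci * (RtoC t + x))%C) <= (3 + Rabs (t + Re x)) * 10.
Proof.
  intros Hx; assert (Hd := Udomain_pole_dist t x Hx); destruct Hx as [Hx1 Hx2].
  assert (Hre := Re_zeta_arg_ge t x ltac:(lra)).
  eapply Rle_trans; [apply Cmod_zeta_trunc_le; [lra |] |].
  - apply Udomain_zeta_arg_neq1; split; assumption.
  - apply Rmult_le_compat; [apply Cmod_ge_0 | | apply Cmod_zeta_arg_le, Hx1 |].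
    + apply Rplus_le_le_0_compat; left; apply Rinv_0_lt_compat; lra.
    + replace 10 with (/ (1/8) + / (1/2)) by field.
      apply Rplus_le_compat; apply Rinv_le_contravar; lra.
Qed.

Definition Udecay (t r : R) : R := 1280 * exp 2 * t ^ 2 * exp (- (1/2 * r)).

Lemma Cmod_Uintegrand_seq_le (n : nat) (t : R) (x : C) :
  3 <= t -> 1 <= Rabs (Re x) -> Udomain t x ->
  Cmod (Uintegrand_seq n t x) <= Udecay t (Rabs (Re x)).
Proof.
  intros Ht Hu Hx; unfold Uintegrand_seq, Udecay; rewrite !Cmod_mult.
  assert (B1 := Cmod_cexp_RStheta_seq_le n t x Hx); assert (B2 := Cmod_zeta_trunc_arg_le n t x Hx).
  assert (B3 := Cmod_Ukernel_le_exp x Hu).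
  set (u := Rabs (Re x)) in *; set (v := Rabs (t + Re x)) in *.
  assert (Hv0 : 0 <= v) by apply Rabs_pos.
  (* Half of the decay of the kernel is spent on the polynomial factors. *)
  assert (Hv : 3 + v <= 4 * t * exp (u / 4)).
  { assert (v <= t + u)
      by (eapply Rle_trans; [apply Rabs_triang |]; rewrite (Rabs_pos_eq t) by lra; apply Rle_refl).
    pose proof (exp_ineq1_le (u / 4)); nra. }
  assert (E : exp (- (1/2 * u)) = exp (u / 4) * exp (u / 4) * exp (- u))
    by (rewrite <- !exp_plus; f_equal; field).
  rewrite E; assert (Hq := exp_pos (u / 4)); set (q := exp (u / 4)) in *.
  assert (He := exp_pos 2); assert (Hr := exp_pos (- u)).
  apply Rle_trans with (exp 2 * (2 + v) * ((3 + v) * 10) * (8 * exp (- u))).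
  - apply Rmult_le_compat; auto using Rmult_le_pos, Cmod_ge_0.
    apply Rmult_le_compat; auto using Cmod_ge_0.
  - replace (exp 2 * (2 + v) * ((3 + v) * 10) * (8 * exp (- u)))
      with (80 * exp 2 * exp (- u) * ((2 + v) * (3 + v))) by ring.
    replace (1280 * exp 2 * t ^ 2 * (q * q * exp (- u)))
      with (80 * exp 2 * exp (- u) * ((4 * t * q) * (4 * t * q))) by ring.
    apply Rmult_le_compat_l; [apply Rmult_le_pos; lra |]; apply Rmult_le_compat; lra.
Qed.

Definition Usegment (t y b : R) (x : C) : Prop := Udomain t x /\ Im x = y /\ Rabs (Re x) <= b.

Lemma Usegment_Rabs_le (t y b : R) (x : C) : Usegment t y b x -> Rabs (t + Re x) <= Rabs t + b.
Proof. intros (_ & _ & Hx); eapply Rle_trans; [apply Rabs_triang | lra]. Qed.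

Lemma unif_bounded_cexp_RStheta_seq (t y b : R) : unif_bounded (Usegment t y b)
  (fun n x => cexp (Ci * RStheta_seq (S n) (RtoC t + x) - Ci * RStheta (RtoC t))%C).
Proof.
  exists (exp 2 * (2 + (Rabs t + b))); intros n x Hx.
  eapply Rle_trans; [apply Cmod_cexp_RStheta_seq_le, Hx |].
  apply Rmult_le_compat_l; [left; apply exp_pos | pose proof (Usegment_Rabs_le t y b x Hx); lra].
Qed.

Lemma cvg_unif_cexp_RStheta_seq (t y b : R) : cvg_unif (Usegment t y b)
  (fun n x => cexp (Ci * RStheta_seq (S n) (RtoC t + x) - Ci * RStheta (RtoC t))%C)
  (fun x => cexp (Ci * RStheta (RtoC t + x) - Ci * RStheta (RtoC t))%C).
Proof.
  apply cvg_unif_cexp; [apply unif_bounded_cexp_RStheta_seq |].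
  apply (cvg_unif_lipschitz _ (fun n x => RStheta_seq (S n) (RtoC t + x)%C)
    (fun x => RStheta (RtoC t + x)%C) _ _ 1 Rlt_0_1).
  - intros n x _; right; rewrite <- Cmod_Ci, <- Cmod_mult; f_equal; ring.
  - apply (cvg_unif_incr_1 _ (fun n x => RStheta_seq n (RtoC t + x)%C)).
    apply (cvg_unif_comp _ (fun w => Cmod w <= Rabs t + b + 2) RStheta_seq RStheta);
      [| apply RStheta_seq_cvg_unif].
    intros x Hx; pose proof (Usegment_Rabs_le t y b x Hx); destruct Hx as [[Him _] _].
    eapply Rle_trans; [apply Cmod_le_Rabs |]; simpl.
    unfold Re, Im in *; rewrite (Rabs_left (0 + snd x)); lra.
Qed.

Lemma unif_bounded_zeta_trunc_arg (t y b : R) : unif_bounded (Usegment t y b)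
  (fun n x => zeta_trunc n (RtoC (1/2) + Ci * (RtoC t + x))%C).
Proof.
  exists ((3 + (Rabs t + b)) * 10); intros n x Hx; pose proof (Usegment_Rabs_le t y b x Hx).
  eapply Rle_trans; [apply Cmod_zeta_trunc_arg_le, Hx | lra].
Qed.

Lemma cvg_unif_zeta_trunc_arg (t y b : R) : cvg_unif (Usegment t y b)
  (fun n x => zeta_trunc n (RtoC (1/2) + Ci * (RtoC t + x))%C)
  (fun x => zeta (RtoC (1/2) + Ci * (RtoC t + x))%C).
Proof.
  apply (cvg_unif_comp _ _ zeta_trunc zeta (fun x => RtoC (1/2) + Ci * (RtoC t + x))%C)
    with (2 := zeta_trunc_cvg_unif (1/2) (3 + (Rabs t + b)) ltac:(lra)).
  intros x Hx; pose proof (Usegment_Rabs_le t y b x Hx); destruct Hx as [Hdom _].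
  assert (Him := proj1 Hdom); split; [| split].
  - apply Re_zeta_arg_ge; lra.
  - eapply Rle_trans; [apply Cmod_zeta_arg_le, Him | lra].
  - apply Udomain_zeta_arg_neq1, Hdom.
Qed.

Lemma Uintegrand_seq_cvg_unif (t y b : R) : -2 < y < 0 ->
  cvg_unif (Usegment t y b) (fun n => Uintegrand_seq n t) (Uintegrand t).
Proof.
  intros Hy; apply cvg_unif_mult; [apply unif_bounded_mult | | apply cvg_unif_mult |].
  - apply unif_bounded_cexp_RStheta_seq.
  - apply unif_bounded_zeta_trunc_arg.
  - apply (unif_bounded_Ukernel _ y Hy); intros x (_ & Hx & _); exact Hx.
  - apply unif_bounded_cexp_RStheta_seq.
  - apply unif_bounded_zeta_trunc_arg.
  - apply cvg_unif_cexp_RStheta_seq.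
  - apply cvg_unif_zeta_trunc_arg.
  - apply cvg_unif_const.
Qed.

Lemma Uintegrand_seq_cvg_unif_segment (t y a b : R) : -2 < y < 0 ->
  (forall u, a <= u <= b -> Udomain t (u, y)) ->
  cvg_unif (fun u => a <= u <= b) (fun n u => Uintegrand_seq n t (u, y))
    (fun u => Uintegrand t (u, y)).
Proof.
  intros Hy Hdom.
  apply (cvg_unif_comp _ _ (fun n => Uintegrand_seq n t) (Uintegrand t) (fun u => (u, y)))
    with (2 := Uintegrand_seq_cvg_unif t y (Rmax (Rabs a) (Rabs b)) Hy).
  intros u Hu; split; [apply Hdom, Hu | split; [reflexivity |]].
  apply RmaxAbs; apply Hu.
Qed.

Lemma ex_RInt_Uintegrand (t y a b : R) : -2 < y < 0 -> a <= b ->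
  (forall u, a <= u <= b -> Udomain t (u, y)) -> ex_RIntC (fun u => Uintegrand t (u, y)) a b.
Proof.
  intros Hy Hab Hdom.
  apply (cvg_unif_RInt (fun n u => Uintegrand_seq n t (u, y)) _ a b Hab).
  - intros n; apply (ex_RInt_horizontal (Udomain t)); auto using holomorphic_on_Uintegrand_seq.
  - apply Uintegrand_seq_cvg_unif_segment; assumption.
Qed.

Lemma Cmod_Uintegrand_le (t : R) (x : C) : 3 <= t -> 1 <= Rabs (Re x) -> Udomain t x ->
  Cmod (Uintegrand t x) <= Udecay t (Rabs (Re x)).
Proof.
  intros Ht Hu Hx.
  apply (cvg_unif_Cmod_le _ _ _ x)
    with (1 := Uintegrand_seq_cvg_unif t (Im x) (Rabs (Re x)) (proj1 Hx)).
  - repeat split; try apply Hx; apply Rle_refl.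
  - intros n; apply Cmod_Uintegrand_seq_le; assumption.
Qed.

Lemma Udomain_far (t u y : R) : -2 < y < 0 -> 1/2 < t + u -> Udomain t (u, y).
Proof. intros Hy Hu; split; simpl; lra. Qed.

(** * Truncating and moving the line of integration *)

Lemma Cmod_RInt_exp_le (f : R -> C) (K c a b : R) : c <> 0 -> a <= b -> ex_RIntC f a b ->
  (forall u, a <= u <= b -> Cmod (f u) <= K * exp (- (c * u))) ->
  Cmod (RIntC f a b) <= K / c * (exp (- (c * a)) - exp (- (c * b))).
Proof.
  intros Hc Hab Hex Hf.
  replace (K / c * (exp (- (c * a)) - exp (- (c * b))))
    with (- (K / c) * exp (- (c * b)) - - (K / c) * exp (- (c * a))) by ring.
  apply (Cmod_RInt_le_primitive f (fun u => - (K / c) * exp (- (c * u)))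
           (fun u => K * exp (- (c * u)))); [exact Hab | exact Hex | | | exact Hf]; intros u _.
  - auto_derive; [auto | field; exact Hc].
  - apply (ex_derive_continuous (V:=R_NormedModule)); auto_derive; auto.
Qed.

Section ExponentialDecay.

Variables (f : R -> C) (K c : R).
Hypotheses (HK : 0 <= K) (Hc : 0 < c).
Hypothesis Hex : forall a b, a <= b -> ex_RIntC f a b.
Hypothesis Hdecay : forall u, 1 <= Rabs u -> Cmod (f u) <= K * exp (- (c * Rabs u)).

Lemma Cmod_RInt_tails_le (b a' b' : R) : 1 <= b -> a' <= - b -> b <= b' ->
  Cmod (RIntC f a' b' - RIntC f (- b) b)%C <= 2 * K / c * exp (- (c * b)).
Proof.
  intros Hb Ha' Hb'.
  assert (Hleft : Cmod (RIntC f a' (- b)) <= K / - c * (exp (- (- c * a')) - exp (- (- c * - b)))).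
  { apply Cmod_RInt_exp_le; [lra | exact Ha' | apply Hex, Ha' |]; intros u Hu.
    specialize (Hdecay u); rewrite Rabs_left in Hdecay by lra.
    replace (- c * u) with (c * - u) by ring; apply Hdecay; lra. }
  assert (Hright : Cmod (RIntC f b b') <= K / c * (exp (- (c * b)) - exp (- (c * b')))).
  { apply Cmod_RInt_exp_le; [lra | exact Hb' | apply Hex, Hb' |]; intros u Hu.
    specialize (Hdecay u); rewrite Rabs_pos_eq in Hdecay by lra; apply Hdecay; lra. }
  rewrite (RIntC_Chasles f a' (- b) b'), (RIntC_Chasles f (- b) b b') by (apply Hex; lra).
  replace (_ - _)%C with (RIntC f a' (- b) + RIntC f b b')%C by ring.
  eapply Rle_trans; [apply Cmod_triangle |].
  replace (K / - c) with (- (K / c)) in Hleft by (field; lra).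
  replace (- c * - b) with (c * b) in Hleft by ring.
  assert (HKc : 0 <= K / c) by (apply Rdiv_le_0_compat; lra).
  pose proof (exp_pos (- (- c * a'))); pose proof (exp_pos (- (c * b'))).
  replace (2 * K / c) with (2 * (K / c)) by (unfold Rdiv; ring); nra.
Qed.

Lemma filter_prod_m_infty_p_infty (M : R) :
  filter_prod (Rbar_locally m_infty) (Rbar_locally p_infty) (fun ab => fst ab < - M /\ M < snd ab).
Proof.
  apply (Filter_prod _ _ _ (fun x => x < - M) (fun y => M < y)); [exists (- M) | exists M |]; auto.
Qed.

Lemma ex_RInt_gen_exp_decay :
  @ex_RInt_gen C_R_NormedModule f (Rbar_locally m_infty) (Rbar_locally p_infty).
Proof.
  apply (ex_RInt_gen_cauchy f (Rbar_locally m_infty) (Rbar_locally p_infty)).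
  - generalize (filter_prod_m_infty_p_infty 0); apply filter_imp; intros ab Hab; apply Hex; lra.
  - intros eps; assert (Heps := cond_pos eps).
    assert (Hd : 0 < eps / (2 * K / c + 1)).
    { apply Rdiv_lt_0_compat; [exact Heps |].
      assert (0 <= 2 * K / c) by (apply Rdiv_le_0_compat; lra); lra. }
    destruct (exists_exp_opp_mult_ln_lt c _ (exp 1) Hc Hd) as (A & HA1 & HA).
    assert (HlnA : 1 < ln A)
      by (rewrite <- (ln_exp 1); apply ln_increasing; [apply exp_pos | exact HA1]).
    exists (RIntC f (- ln A) (ln A)).
    generalize (filter_prod_m_infty_p_infty (ln A)); apply filter_imp; intros [a b] [Ha Hb].
    cbn [fst snd] in *.
    eapply Rle_lt_trans; [apply Cmod_RInt_tails_le; lra |].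
    assert (0 <= 2 * K / c) by (apply Rdiv_le_0_compat; lra).
    apply Rlt_div_r in HA; [| lra]; pose proof (exp_pos (- (c * ln A))); lra.
Qed.

Lemma Cmod_RInt_gen_exp_decay_minus_le (b : R) : 1 <= b ->
  Cmod (@RInt_gen C_R_CompleteNormedModule f (Rbar_locally m_infty) (Rbar_locally p_infty)
        - RIntC f (- b) b)%C <= 2 * K / c * exp (- (c * b)).
Proof.
  intros Hb; apply (Cmod_RInt_gen_minus_le f (Rbar_locally m_infty) (Rbar_locally p_infty));
    [apply ex_RInt_gen_exp_decay |].
  generalize (filter_prod_m_infty_p_infty b); apply filter_imp; intros [a' b'] [Ha' Hb'].
  cbn [fst snd] in *; apply Cmod_RInt_tails_le; lra.
Qed.

End ExponentialDecay.

Lemma Cmod_RInt_Uintegrand_shift_le (t b y : R) : 3 <= t -> 1 <= b -> b + 1 <= t -> -2 < y < 0 ->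
  Cmod (RIntC (fun u => Uintegrand t (u, y)) (- b) b
        - RIntC (fun u => Uintegrand t (u, (- (1/4))%R)) (- b) b)%C
  <= 4 * Udecay t b.
Proof.
  intros Ht Hb Hbt Hy; set (M := Udecay t b).
  assert (HM : 0 <= M)
    by (unfold M, Udecay; repeat apply Rmult_le_pos; try lra; left; apply exp_pos).
  assert (Hdom : forall u v, - b - 1/2 < u < b + 1/2 -> -2 < v < 0 -> Udomain t (u, v))
    by (intros u v Hu Hv; apply Udomain_far; lra).
  apply Rle_trans with (2 * M * Rabs (y - - (1/4))).
  2:{ assert (Rabs (y - - (1/4)) <= 2) by (apply Rabs_le; lra); nra. }
  apply (Cmod_horizontal_RInt_minus_le_lim (- b - 1/2) (- b) b (b + 1/2) (-2) 0
    (fun n => Uintegrand_seq n t)); try lra.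
  - intros n; apply (holomorphic_on_subset (Udomain t)); [| apply holomorphic_on_Uintegrand_seq].
    intros [u v] [Hu Hv]; apply Hdom; assumption.
  - intros n v Hv.
    assert (Hv0 : -2 < v < 0).
    { assert (-2 < Rmin (- (1/4)) y) by (apply Rmin_glb_lt; lra).
      assert (Rmax (- (1/4)) y < 0) by (apply Rmax_lub_lt; lra); lra. }
    split; (eapply Rle_trans;
      [apply Cmod_Uintegrand_seq_le; [exact Ht | | apply Hdom; [lra | exact Hv0]] |]);
      unfold M; cbn [Re fst]; rewrite ?Rabs_Ropp, Rabs_pos_eq by lra; lra.
  - apply Uintegrand_seq_cvg_unif_segment; [lra |]; intros u Hu; apply Hdom; lra.
  - apply Uintegrand_seq_cvg_unif_segment; [lra |]; intros u Hu; apply Hdom; lra.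
Qed.

Lemma horizontal_line_eq (s u : R) : (RtoC u - Ci * RtoC s)%C = (u, - s).
Proof. apply injective_projections; simpl; ring. Qed.

Lemma Useg_eq (s b t : R) :
  Useg s b t = (/ (RtoC (2 * PI) * Ci) * RIntC (fun u => Uintegrand t (u, (- s)%R)) (- b) b)%C.
Proof.
  unfold Useg; f_equal; apply (RInt_ext (V:=C_R_CompleteNormedModule)); intros u _.
  rewrite horizontal_line_eq; reflexivity.
Qed.

Lemma Cmod_prefactor_mult_le (z w : C) (M : R) : Cmod (z - w)%C <= M ->
  Cmod (/ (RtoC (2 * PI) * Ci) * z - / (RtoC (2 * PI) * Ci) * w)%C <= M.
Proof.
  intros H; assert (HP := PI2_3_2).
  assert (HC : (RtoC (2 * PI) * Ci)%C <> 0%C).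
  { apply Cmult_neq_0; [apply RtoC_neq0; lra | apply Ci_nz]. }
  replace (_ - _)%C with (/ (RtoC (2 * PI) * Ci) * (z - w))%C by ring.
  rewrite Cmod_mult, Cmod_inv, Cmod_mult, Cmod_Ci, Cmod_R, Rabs_pos_eq by (exact HC || lra).
  rewrite Rmult_1_r; assert (/ (2 * PI) <= 1) by (rewrite <- Rinv_1; apply Rinv_le_contravar; lra).
  pose proof (Cmod_ge_0 (z - w)%C); nra.
Qed.

Lemma Cmod_U_minus_Useg_quarter_le (t b : R) : 3 <= t -> 1 <= b ->
  Cmod (U t - Useg (1/4) b t)%C <= 4 * Udecay t b.
Proof.
  intros Ht Hb; set (K := 1280 * exp 2 * t ^ 2).
  assert (HK : 0 <= K) by (repeat apply Rmult_le_pos; try lra; left; apply exp_pos).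
  pose (f := fun u : R => Uintegrand t (u, (- (1/4))%R)).
  assert (Hex : forall a a', a <= a' -> ex_RIntC f a a').
  { intros a a' Ha; apply (ex_RInt_Uintegrand t (- (1/4)) a a'); [lra | exact Ha |].
    intros u _; split; simpl; lra. }
  assert (Hdecay : forall u, 1 <= Rabs u -> Cmod (f u) <= K * exp (- (1/2 * Rabs u))).
  { intros u Hu; apply (Cmod_Uintegrand_le t (u, (- (1/4))%R)); [exact Ht | exact Hu |].
    split; simpl; lra. }
  rewrite Useg_eq; unfold U, Uline.
  rewrite <- (RInt_gen_ext_eq (V:=C_R_CompleteNormedModule) f).
  2:{ intros u; rewrite horizontal_line_eq; reflexivity. }
  2:{ apply (ex_RInt_gen_exp_decay f K (1/2)); auto; lra. }
  apply Cmod_prefactor_mult_le.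
  replace (4 * Udecay t b) with (2 * K / (1/2) * exp (- (1/2 * b))) by (unfold K, Udecay; field).
  apply (Cmod_RInt_gen_exp_decay_minus_le f K (1/2)); auto; lra.
Qed.

Lemma Cmod_Useg_minus_Useg_quarter_le (t b s : R) : 3 <= t -> 1 <= b -> b + 1 <= t -> 0 < s < 2 ->
  Cmod (Useg s b t - Useg (1/4) b t)%C <= 4 * Udecay t b.
Proof.
  intros Ht Hb Hbt Hs; rewrite !Useg_eq.
  apply Cmod_prefactor_mult_le, Cmod_RInt_Uintegrand_shift_le; lra.
Qed.

Lemma mult_ln_add1_le (c t : R) : 1 <= c -> (2 * c + 2) ^ 2 <= t -> c * ln t + 1 <= t.
Proof.
  intros Hc Ht.
  assert (Ht0 : 0 < t) by nra.
  assert (Hs : 2 * c + 2 <= sqrt t)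
    by (rewrite <- (sqrt_pow2 (2 * c + 2)) by lra; apply sqrt_le_1_alt, Ht).
  assert (Hq := sqrt_sqrt t (Rlt_le _ _ Ht0)).
  assert (Hln : ln t <= 2 * (sqrt t - 1)).
  { pose proof (ln_le_sub1 (sqrt t) ltac:(lra)) as L; rewrite ln_sqrt_half in L by exact Ht0; lra. }
  nra.
Qed.

Lemma Udecay_mult_ln (n : nat) (t : R) : 0 < t ->
  Udecay t (2 * INR (n + 2) * ln t) = 1280 * exp 2 * / t ^ n.
Proof.
  intros Ht; unfold Udecay.
  replace (1/2 * (2 * INR (n + 2) * ln t)) with (INR (n + 2) * ln t) by field.
  rewrite exp_Ropp; change (exp (INR (n + 2) * ln t)) with (Rpower t (INR (n + 2))).
  rewrite Rpower_pow, pow_add by exact Ht; field; split; [apply pow_nonzero |]; lra.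
Qed.

Theorem mainTheorem2 (n : nat) (sigma0 : R) (Hs : 0 < sigma0 < 2) :
  exists C0 : R, 0 < C0 /\
  exists K T0 : R, 0 < K /\ 0 < T0 /\
    forall t : R, T0 <= t ->
      Cmod (U t - Useg sigma0 (C0 * ln t) t)%C <= K * / (t ^ n).
Proof.
  pose (C0 := 2 * INR (n + 2)).
  assert (HC0 : 4 <= C0) by (unfold C0; rewrite plus_INR; simpl; pose proof (pos_INR n); lra).
  exists C0; split; [lra |]; exists (8 * (1280 * exp 2)), ((2 * C0 + 2) ^ 2).
  split; [pose proof (exp_pos 2); lra |]; split; [nra |]; intros t HT.
  assert (Ht : 3 <= t) by nra.
  assert (Hbt : C0 * ln t + 1 <= t) by (apply mult_ln_add1_le; lra).
  assert (Hb : 1 <= C0 * ln t).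
  { pose proof (ln_ge_1_sub_inv t ltac:(lra)).
    assert (/ t <= / 3) by (apply Rinv_le_contravar; lra); nra. }
  set (b := C0 * ln t) in *.
  assert (Hdecay : Udecay t b = 1280 * exp 2 * / t ^ n) by (apply Udecay_mult_ln; lra).
  assert (Htail := Cmod_U_minus_Useg_quarter_le t b Ht Hb).
  assert (Hshift := Cmod_Useg_minus_Useg_quarter_le t b sigma0 Ht Hb Hbt Hs).
  rewrite Hdecay in Htail, Hshift.
  replace (U t - Useg sigma0 b t)%C
    with ((U t - Useg (1/4) b t) + - (Useg sigma0 b t - Useg (1/4) b t))%C by ring.
  eapply Rle_trans; [apply Cmod_triangle |]; rewrite Cmod_opp; lra.
Qed.
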